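(* Let $K\subseteq\mathbb{R}^n$ be a symmetric convex body with $\gamma_n(K)\ge 1/2$, and let $\mathsf{p}$ be a probability distribution on $\mathbb{R}^n$ with sub-exponential tails that is supported on vectors of Euclidean norm at most $1$. For vectors $v_1,\dots,v_T$ sampled i.i.d. from $\mathsf{p}$ and revealed one at a time, there is an online algorithm choosing signs $\chi_t\in\{\pm1\}$ that, with high probability, maintains the discrepancy vector $d_t=\sum_{\tau=1}^t\chi_\tau v_\tau$ satisfying $d_t\in C\log^5(nT)\cdot K$ for all $t\in[T]$, where $C$ is a universal constant.
   Context: $\gamma_n$ is the standard Gaussian measure on $\mathbb{R}^n$: $\gamma_n(A)=\mathbb{P}[G\in A]$ for $G$ a standard Gaussian vector in $\mathbb{R}^n$. A distribution $\mathsf{p}$ on $\mathbb{R}^n$ has sub-exponential tails if there is a universal constant $c>0$ such that for every unit vector $\theta$ and every $r>0$, $\mathbb{P}_{v\sim\mathsf{p}}\big[|\langle v,\theta\rangle-\mu_\theta|\ge \sigma_\theta r\big]\le e^{-cr}$, where $\mu_\theta,\sigma_\theta$ are the mean and standard deviation of $\langle v,\theta\rangle$. The algorithm is online: $\chi_t$ is chosen irrevocably upon arrival of $v_t$, using only $v_1,\dots,v_t$, earlier choices, knowledge of $\mathsf{p}$ and $K$, and possibly internal randomness. ''With high probability'' refers to the randomness of inputs and algorithm. *)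

(* Defs.v *)
From HB Require Import structures.
From mathcomp Require Import all_boot all_order all_algebra.
From mathcomp Require Import all_classical all_reals all_analysis.

Set Implicit Arguments.
Unset Strict Implicit.
Unset Printing Implicit Defensive.

Import Order.TTheory GRing.Theory Num.Theory.
Import numFieldNormedType.Exports.

Local Open Scope classical_set_scope.
Local Open Scope ring_scope.

(* R^n is 'rV[R]_n. Its sigma-algebra is the one generated by the coordinate
   maps, as for n.-tuple; it coincides with the Borel sigma-algebra. *)
Definition rV_display : measure_display -> measure_display.
Proof. exact. Qed.

Section rV_measurable.
Context (R : realType) (n : nat).

Let coord : 'I_n -> 'rV[R]_n -> R := fun i x => x ord0 i.

Let rV_set0 : g_sigma_preimage coord set0.
Proof. exact: sigma_algebra0. Qed.

Let rV_setC A : g_sigma_preimage coord A -> g_sigma_preimage coord (~` A).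
Proof. exact: sigma_algebraC. Qed.

Let rV_bigcup (F : (set 'rV[R]_n)^nat) :
  (forall i, g_sigma_preimage coord (F i)) ->
  g_sigma_preimage coord (\bigcup_i (F i)).
Proof. exact: sigma_algebra_bigcup. Qed.

HB.instance Definition _ := @isMeasurable.Build
  (rV_display default_measure_display) 'rV[R]_n (g_sigma_preimage coord)
  rV_set0 rV_setC rV_bigcup.

End rV_measurable.

Section iid.
Context d (T : measurableType d) (R : realType).

Definition tcons n (x : T * n.-tuple T) : n.+1.-tuple T :=
  [tuple of x.1 :: x.2].

Lemma measurable_tcons n : measurable_fun setT (@tcons n).
Proof. exact: measurable_cons. Qed.

HB.instance Definition _ n :=
  isMeasurableFun.Build _ _ _ _ (@tcons n) (@measurable_tcons n).

Local Open Scope ereal_scope.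

(* The law of n independent samples from P, i.e. the n-fold product measure. *)
Fixpoint iid (P : probability T R) n : probability (n.-tuple T) R :=
  match n with
  | 0 => \d_([tuple] : 0.-tuple T)
  | m.+1 => distribution (P \x iid P m) (@tcons m)
  end.

Lemma iid_box (P : probability T R) n (A : 'I_n -> set T) :
  (forall i, measurable (A i)) ->
  iid P n [set x | forall i, A i (tnth x i)] = \prod_(i < n) P (A i).
Proof.
elim: n A => [|n ih] A mA /=.
  by rewrite big_ord0 /dirac indicE mem_set// => -[].
rewrite big_ord_recl /= /distribution /pushforward -ih => [|i]; last exact: mA.
rewrite -product_measure1E//; last first.
  rewrite (_ : mkset _ = \bigcap_(i in [set: 'I_n])
      ((fun x => tnth x i) @^-1` A (lift ord0 i))); last first.
    by apply/seteqP; split=> x /= h i => [_|]; exact: h.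
  apply: fin_bigcap_measurable => // i _.
  by rewrite -[X in measurable X]setTI; exact: measurable_tnth.
congr (_ _); apply/seteqP; split=> -[x y] /= h.
  by split=> [|i]; [exact: (h ord0)|have := h (lift ord0 i); rewrite tnthS].
case: h => h0 h1 i; case: (unliftP ord0 i) => [j|] -> //.
by rewrite tnthS; exact: h1.
Qed.

End iid.

Section gaussian.
Context (R : realType) (n : nat).

Definition row_of_tuple (x : n.-tuple (measurableTypeR R)) : 'rV[R]_n :=
  \row_i (tnth x i : R).

Lemma measurable_row_of_tuple : measurable_fun setT row_of_tuple.
Proof.
move=> _ B; rewrite setTI; move: B.
suff : measurable `<=` image_set_system setT row_of_tuple measurable.
  by move=> h B /h; rewrite /image_set_system/= setTI.
apply: smallest_sub; first exact/sigma_algebra_image/sigma_algebra_measurable.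
rewrite -bigcup_seq => B [i _ [C mC <-]].
rewrite /image_set_system/= !setTI.
rewrite (_ : _ @^-1` _ = (fun x => tnth x i) @^-1` C); last first.
  by apply/funext => x /=; rewrite mxE.
by rewrite -[X in measurable X]setTI; exact: measurable_tnth.
Qed.

HB.instance Definition _ :=
  isMeasurableFun.Build _ _ _ _ row_of_tuple measurable_row_of_tuple.

Definition std_gaussian : probability 'rV[R]_n R :=
  distribution (iid (normal_prob 0 1) n) row_of_tuple.

End gaussian.

Section euclidean.
Context (R : realType) (n : nat).
Implicit Types u v : 'rV[R]_n.

Definition dotv u v : R := \sum_(i < n) u ord0 i * v ord0 i.

(* The library norm `|v| on matrices is the sup norm. *)
Definition norm2 v : R := Num.sqrt (dotv v v).

Definition symmetric_convex_body (K : set 'rV[R]_n) : Prop :=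
  [/\ convex_set K, compact K, interior K !=set0 &
      forall x, K x -> K (- x)].

End euclidean.

Section tails.
Context (R : realType) (n : nat) (p : probability 'rV[R]_n R).

Definition dir_mean (theta : 'rV[R]_n) : R :=
  fine 'E_p[fun v => dotv v theta].

Definition dir_std (theta : 'rV[R]_n) : R :=
  Num.sqrt (fine 'V_p[fun v => dotv v theta]).

Definition sub_exponential_tails (c : R) : Prop :=
  forall theta : 'rV[R]_n, norm2 theta = 1 -> forall r : R, 0 < r ->
    (p [set v | (dir_std theta * r <= `|dotv v theta - dir_mean theta|)%R]
      <= (expR (- (c * r)))%:E)%E.

Definition supported_in_unit_ball : Prop :=
  p [set v | norm2 v <= 1] = 1%E.

End tails.

(* A randomized online algorithm: the internal randomness is a random seed,
   drawn independently of the input; at time t the sign is computed from the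
   vectors v_1, ..., v_t, the t - 1 earlier signs, and the seed. Signs are
   booleans, true standing for +1. *)
Record online_alg (R : realType) (n : nat) := OnlineAlg {
  seed_display : measure_display;
  seed : measurableType seed_display;
  seed_law : probability seed R;
  rule : seq 'rV[R]_n -> seq bool -> seed -> bool;
  measurable_rule : forall (t : nat) (e : seq bool),
    measurable_fun [set: t.-tuple 'rV[R]_n * seed]
      (fun x => rule (tval x.1) e x.2)
}.

Section run.
Context (R : realType) (n : nat) (A : online_alg R n).

Fixpoint signs (v : seq 'rV[R]_n) (s : seed A) (t : nat) : seq bool :=
  if t is t'.+1 then
    rcons (signs v s t') (rule (take t v) (signs v s t') s)
  else [::].

Definition disc (v : seq 'rV[R]_n) (s : seed A) (t : nat) : 'rV[R]_n :=
  \sum_(i < t) (if nth true (signs v s t) i then 1 else -1) *: nth 0 v i.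

End run.

(* Main.v *)
Require Import Defs.
From HB Require Import structures.
From mathcomp Require Import all_boot all_order all_algebra.
From mathcomp Require Import all_classical all_reals all_analysis.
From mathcomp Require Import measurable_realfun ring lra.

(* The signs are those of the self-balancing walk of Alweiss, Liu and Sawhney: at
   position [w] the vector [v] gets sign [+] with probability
   [1/2 - <w, v> / (2 c)], where [c] is of order [log (n T)]. As long as
   [|<w, v>| <= c], the new position has mean [w - (<w, v> / c) v] and deviates
   from it by at most [2 v]. Hence, for convex [f], its [f]-average is at most the
   average of [f] over an autoregressive Gaussian step [A w + s g v], and for
   [sigma^2 = O(c)] the Gaussian measure of variance [sigma^2] does not increase
   averages of convex functions under that step: a rotation in the plane spanned
   by [v] and the independent noise [g] turns [sigma G] into [A (sigma G) + s g v].
   So the position at each time is dominated, in the convex order, by [sigma G].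
   Testing with [exp (eta |<x, v>|)] bounds the probability that
   [|<w, v>| > c]; testing with [exp (lambda ||x||_K)], whose Gaussian mean is
   bounded by Fernique's theorem, bounds the probability of leaving a multiple
   of [K]. This holds for every fixed sequence of vectors of norm at most [1]. *)

Set Implicit Arguments.
Unset Strict Implicit.
Unset Printing Implicit Defensive.

Import Order.TTheory GRing.Theory Num.Theory.
Import numFieldNormedType.Exports.

Local Open Scope classical_set_scope.
Local Open Scope ring_scope.

(** * Integration against the one-dimensional normal law *)

Section normal_integral.
Context {R : realType}.
Local Open Scope ereal_scope.
Local Notation mu := (@lebesgue_measure R).

(** The Radon-Nikodym derivative and [normal_pdf] have the same integral over every measurable set,
    hence agree almost everywhere. *)
Lemma ge0_integral_normal_prob (f : measurableTypeR R -> \bar R) :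
  measurable_fun setT f -> (forall x, 0 <= f x) ->
  \int[normal_prob (0 : R) 1]_x f x =
  \int[mu]_x (f x * (normal_pdf (0 : R) 1 x)%:E).
Proof.
move=> mf f0.
have dom := @normal_prob_dominates R 0 1.
have mpdf : measurable_fun setT (fun x : measurableTypeR R =>
    (normal_pdf (0 : R) 1 x)%:E).
  by apply/measurable_EFinP; exact: measurable_normal_pdf.
rewrite -(Radon_Nikodym_SigmaFinite.change_of_variables dom f0 measurableT mf).
have mRN : measurable_fun setT
    (Radon_Nikodym_SigmaFinite.f (normal_prob (0 : R) 1) mu).
  exact: measurable_int (Radon_Nikodym_SigmaFinite.f_integrable dom).
apply: ge0_ae_eq_integral => //.
- exact: emeasurable_funM.
- exact: emeasurable_funM.
- by move=> x _; rewrite mule_ge0// Radon_Nikodym_SigmaFinite.f_ge0.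
- by move=> x _; rewrite mule_ge0// lee_fin normal_pdf_ge0.
apply: ae_eqe_mul2l; apply: integral_ae_eq => //.
- exact: Radon_Nikodym_SigmaFinite.f_integrable.
- by move=> A _ mA; rewrite -Radon_Nikodym_SigmaFinite.f_integral.
Qed.

Lemma lebesgue_measure_translation (h : R) (A : set R) : measurable A ->
  pushforward mu ((fun x => x + h)%R : measurableTypeR R -> measurableTypeR R) A
  = mu A.
Proof.
move=> mA; apply/esym.
have mT : measurable_fun setT
  ((fun x => x + h)%R : measurableTypeR R -> measurableTypeR R).
  exact: measurable_funD.
pose T : {mfun (measurableTypeR R) >-> (measurableTypeR R)} :=
  HB.pack ((fun x => x + h)%R : measurableTypeR R -> measurableTypeR R)
    (isMeasurableFun.Build _ _ _ _ _ mT).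
apply: (@lebesgue_measure_unique R (pushforward mu T)) => //= _ [[a b]] _ <-.
rewrite /T /pushforward/=.
rewrite (_ : _ @^-1` _ = `](a - h)%R, (b - h)%R]%classic); last first.
  by apply/seteqP; split => x /=; rewrite !in_itv/= ltrBlDr lerBrDr.
rewrite !lebesgue_measure_itv/= !lte_fin ltrD2r; case: ifP => // _.
by rewrite -!EFinB; congr (_%:E); ring.
Qed.

Lemma ge0_integral_translation (h : R) (f : measurableTypeR R -> \bar R) :
  measurable_fun setT f -> (forall x, 0 <= f x) ->
  \int[mu]_x f (x + h)%R = \int[mu]_x f x.
Proof.
move=> mf f0.
have mT : measurable_fun setT
  ((fun x => x + h)%R : measurableTypeR R -> measurableTypeR R).
  exact: measurable_funD.
transitivity (\int[pushforward mu ((fun x => x + h)%R :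
    measurableTypeR R -> measurableTypeR R)]_x f x).
  by rewrite ge0_integral_pushforward.
by apply: eq_measure_integral => //= A mA _; exact: lebesgue_measure_translation.
Qed.

(** The exponential weight is the ratio of the normal densities at [x + h] and at [x], so the claim
    reduces to translation invariance of Lebesgue measure. *)
Lemma normal_translation (h : R) (f : measurableTypeR R -> \bar R) :
  measurable_fun setT f -> (forall x, 0 <= f x) ->
  \int[normal_prob (0 : R) 1]_x
    (f (x + h)%R * (expR (- (x * h) - h ^+ 2 / 2))%:E) =
  \int[normal_prob (0 : R) 1]_x f x.
Proof.
move=> mf f0.
have mfh : measurable_fun setT (fun x : measurableTypeR R => f (x + h)%R).
  by apply: (measurableT_comp mf); exact: measurable_funD.
have mw : measurable_fun setT (fun x : measurableTypeR R =>
    (expR (- (x * h) - h ^+ 2 / 2))%:E).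
  apply/measurable_EFinP; apply: measurableT_comp => //.
  apply: measurable_funB => //; apply: measurableT_comp => //.
  exact: measurable_funM.
have mp : measurable_fun setT (fun x : measurableTypeR R =>
    (normal_pdf (0 : R) 1 x)%:E).
  by apply/measurable_EFinP; exact: measurable_normal_pdf.
rewrite ge0_integral_normal_prob; last 2 first.
- exact: emeasurable_funM.
- by move=> x; rewrite mule_ge0// lee_fin expR_ge0.
rewrite ge0_integral_normal_prob//.
rewrite -(@ge0_integral_translation h
  (fun x => f x * (normal_pdf 0 1 x)%:E)); last 2 first.
- exact: emeasurable_funM.
- by move=> x; rewrite mule_ge0// lee_fin normal_pdf_ge0.
apply: eq_integral => x _; rewrite -muleA -EFinM; congr (_ * _%:E).
rewrite !normal_pdfE ?oner_eq0// mulrCA /normal_fun -expRD; congr (_ * expR _)%R.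
by rewrite !subr0 expr1n -[(1 *+ 2)%R]/(2%:R : R); field.
Qed.

End normal_integral.

(** * Measurability of vector operations *)

Section measurable_row_vectors.
Context {R : realType} d (T : measurableType d).

Lemma measurable_coord n (i : 'I_n) :
  measurable_fun setT (fun x : 'rV[R]_n => x ord0 i).
Proof.
move=> _ Y mY; rewrite setTI; apply: sub_sigma_algebra => /=.
rewrite -bigcup_seq/=; exists i => /=; first by rewrite mem_index_enum.
by exists Y => //; rewrite setTI.
Qed.

Lemma measurable_fun_coordP n (f : T -> 'rV[R]_n) :
  (forall i, measurable_fun setT (fun x => f x ord0 i)) -> measurable_fun setT f.
Proof.
move=> mf _ B; rewrite setTI; move: B.
suff : measurable `<=` image_set_system setT f measurable.
  by move=> h B /h; rewrite /image_set_system/= setTI.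
apply: smallest_sub; first exact/sigma_algebra_image/sigma_algebra_measurable.
rewrite -bigcup_seq => B [i _ [C mC <-]].
rewrite /image_set_system/= !setTI.
by have := mf i measurableT _ mC; rewrite setTI.
Qed.

Lemma measurable_fun_coord n (f : T -> 'rV[R]_n) i :
  measurable_fun setT f -> measurable_fun setT (fun x => f x ord0 i).
Proof. by move=> mf; apply: (measurableT_comp (@measurable_coord n i) mf). Qed.

Lemma measurable_rvD n (f g : T -> 'rV[R]_n) : measurable_fun setT f ->
  measurable_fun setT g -> measurable_fun setT (fun x => f x + g x).
Proof.
move=> mf mg; apply: measurable_fun_coordP => i.
under eq_fun do rewrite mxE.
by apply: measurable_funD; exact: measurable_fun_coord.
Qed.

Lemma measurable_rvZ n (k : T -> R) (f : T -> 'rV[R]_n) : measurable_fun setT k ->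
  measurable_fun setT f -> measurable_fun setT (fun x => k x *: f x).
Proof.
move=> mk mf; apply: measurable_fun_coordP => i.
under eq_fun do rewrite mxE.
by apply: measurable_funM => //; exact: measurable_fun_coord.
Qed.

Lemma measurable_rvN n (f : T -> 'rV[R]_n) :
  measurable_fun setT f -> measurable_fun setT (fun x => - f x).
Proof.
move=> mf; under eq_fun do rewrite -scaleN1r.
exact: measurable_rvZ.
Qed.

Lemma measurable_rvB n (f g : T -> 'rV[R]_n) : measurable_fun setT f ->
  measurable_fun setT g -> measurable_fun setT (fun x => f x - g x).
Proof. by move=> mf mg; apply: measurable_rvD => //; exact: measurable_rvN. Qed.

Lemma measurable_rv_sum n (I : Type) (s : seq I) (f : I -> T -> 'rV[R]_n) :
  (forall i, measurable_fun setT (f i)) ->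
  measurable_fun setT (fun x => \sum_(i <- s) f i x).
Proof.
move=> mf; elim: s => [|i s ih].
  by under eq_fun do rewrite big_nil; exact: measurable_cst.
by under eq_fun do rewrite big_cons; exact: measurable_rvD.
Qed.

Lemma measurable_rvM n m (f : T -> 'rV[R]_n) (B : 'M[R]_(n, m)) :
  measurable_fun setT f -> measurable_fun setT (fun x => f x *m B).
Proof.
move=> mf; apply: measurable_fun_coordP => i.
under eq_fun do rewrite mxE.
apply: measurable_sum => j; apply: measurable_funM => //.
exact: measurable_fun_coord.
Qed.

Lemma measurable_dotv n (f g : T -> 'rV[R]_n) : measurable_fun setT f ->
  measurable_fun setT g -> measurable_fun setT (fun x => dotv (f x) (g x)).
Proof.
move=> mf mg; apply: measurable_sum => j.
by apply: measurable_funM; exact: measurable_fun_coord.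
Qed.

Lemma measurable_expR_fun (f : T -> R) :
  measurable_fun setT f -> measurable_fun setT (fun x => (expR (f x))%:E).
Proof. by move=> mf; apply/measurable_EFinP; exact: measurableT_comp. Qed.

End measurable_row_vectors.

(** * Algebra of the dot product *)

Section dotv_theory.
Context {R : realType} {n : nat}.
Implicit Types u v w : 'rV[R]_n.

Lemma dotvC u v : dotv u v = dotv v u.
Proof. by apply: eq_bigr => i _; rewrite mulrC. Qed.

Lemma dotvDl u v w : dotv (u + v) w = dotv u w + dotv v w.
Proof. by rewrite -big_split; apply: eq_bigr => i _; rewrite mxE mulrDl. Qed.

Lemma dotvZl k u w : dotv (k *: u) w = k * dotv u w.
Proof. by rewrite mulr_sumr; apply: eq_bigr => i _; rewrite mxE mulrA. Qed.

Lemma dotvDr u v w : dotv w (u + v) = dotv w u + dotv w v.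
Proof. by rewrite dotvC dotvDl !(dotvC w). Qed.

Lemma dotvZr k u w : dotv w (k *: u) = k * dotv w u.
Proof. by rewrite dotvC dotvZl (dotvC w). Qed.

Lemma dotvNl u w : dotv (- u) w = - dotv u w.
Proof. by rewrite -scaleN1r dotvZl mulN1r. Qed.

Lemma dotvNr u w : dotv w (- u) = - dotv w u.
Proof. by rewrite dotvC dotvNl dotvC. Qed.

Lemma dotv_ge0 u : 0 <= dotv u u.
Proof. by apply: sumr_ge0 => i _; exact: sqr_ge0. Qed.

Lemma dotv_mulmx m (y : 'rV[R]_m) (B : 'M[R]_(m, n)) u :
  dotv (y *m B) u = dotv y (u *m B^T).
Proof.
rewrite /dotv; under eq_bigr do rewrite mxE mulr_suml.
rewrite exchange_big; apply: eq_bigr => j _.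
rewrite mxE mulr_sumr; apply: eq_bigr => i _.
by rewrite mxE; ring.
Qed.

End dotv_theory.

(** * Translations of the Gaussian measure *)

Section gaussian_translation.
Context {R : realType}.
Local Open Scope ereal_scope.

Lemma ge0_integral_iidS d (T : measurableType d) (P : probability T R) n
    (f : n.+1.-tuple T -> \bar R) :
  measurable_fun setT f -> (forall x, 0 <= f x) ->
  \int[iid P n.+1]_x f x = \int[P]_x \int[iid P n]_y f (tcons (x, y)).
Proof.
move=> mf f0 /=; rewrite /distribution ge0_integral_pushforward//=.
rewrite preimage_setT fubini_tonelli1//.
by apply: measurableT_comp => //; exact: measurable_tcons.
Qed.

Lemma measurable_fun_tuple_add n (h : 'I_n -> R) :
  measurable_fun setT (fun t : n.-tuple (measurableTypeR R) =>
   [tuple (tnth t i + h i)%R | i < n] : n.-tuple (measurableTypeR R)).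
Proof.
apply/measurable_fun_tnthP => i.
rewrite (_ : _ \o _ = fun t : n.-tuple (measurableTypeR R) =>
  (tnth t i + h i)%R : measurableTypeR R); last first.
  by apply/funext => t /=; rewrite tnth_mktuple.
by apply: measurable_funD => //; exact: measurable_tnth.
Qed.

(** Induction on [n]: the head is shifted by [normal_translation], applied to the partial integral
    over the tail, and the weights multiply. *)
Lemma iid_normal_translation n (h : 'I_n -> R)
    (f : n.-tuple (measurableTypeR R) -> \bar R) :
  measurable_fun setT f -> (forall x, 0 <= f x) ->
  \int[iid (normal_prob (0 : R) 1) n]_t
    (f [tuple (tnth t i + h i)%R | i < n] *
     (expR (\sum_(i < n) (- (tnth t i * h i) - h i ^+ 2 / 2)))%:E) =
  \int[iid (normal_prob (0 : R) 1) n]_t f t.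
Proof.
elim: n h f => [|n ih] h f mf f0.
  apply: eq_integral => t _; rewrite big_ord0 expR0 mule1.
  by congr f; rewrite [LHS]tuple0 [RHS]tuple0.
have mw m (k : 'I_m -> R) : measurable_fun setT
    (fun t : m.-tuple (measurableTypeR R) =>
     (expR (\sum_(i < m) (- (tnth t i * k i) - k i ^+ 2 / 2)))%:E).
  apply: measurable_expR_fun; apply: measurable_sum => i.
  apply: measurable_funB => //; apply: measurableT_comp => //.
  by apply: measurable_funM => //; exact: measurable_tnth.
rewrite ge0_integral_iidS; last 2 first.
- apply: emeasurable_funM; last exact: mw.
  by apply: (measurableT_comp mf); exact: measurable_fun_tuple_add.
- by move=> x; apply: mule_ge0 => //; rewrite lee_fin expR_ge0.
rewrite ge0_integral_iidS//.
pose P := iid (normal_prob (0 : R) 1) n.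
pose G := fun x : measurableTypeR R => \int[P]_y f (tcons (x, y)).
have mG : measurable_fun setT G.
  apply: (@measurable_fun_fubini_tonelli_F _ _ _ _ _ _ (f \o @tcons _ _ n));
    last by move=> z; exact: f0.
  by apply: (measurableT_comp mf); exact: measurable_tcons.
have G0 x : 0 <= G x by apply: integral_ge0 => y _; exact: f0.
rewrite -(normal_translation (h ord0) mG G0).
apply: eq_integral => x _.
have mfx : measurable_fun setT (fun t : n.-tuple (measurableTypeR R) =>
    f (tcons ((x + h ord0)%R, t))).
  apply: (measurableT_comp mf).
  by apply: (measurableT_comp (@measurable_tcons _ _ n)); exact: measurable_pair1.
rewrite -[G _](ih (fun i => h (lift ord0 i)) _ mfx); last by move=> t; exact: f0.
rewrite -ge0_integralZr; [|exact: measurableT| | |]; last 3 first.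
- apply: emeasurable_funM; last exact: mw.
  by apply: (measurableT_comp mfx); exact: measurable_fun_tuple_add.
- by move=> t _; rewrite mule_ge0// lee_fin expR_ge0.
- by rewrite lee_fin expR_ge0.
apply: eq_integral => t _; rewrite -muleA -EFinM -expRD big_ord_recl addrC.
congr (f _ * (expR _)%:E); last first.
  by congr (_ + _)%R; apply: eq_bigr => i _; rewrite tnthS.
apply: eq_from_tnth => i; rewrite tnth_mktuple.
by case: (unliftP ord0 i) => [j|] ->; rewrite ?tnthS ?tnth_mktuple.
Qed.

Lemma ge0_integral_std_gaussian n (f : 'rV[R]_n -> \bar R) :
  measurable_fun setT f -> (forall x, 0 <= f x) ->
  \int[std_gaussian R n]_x f x =
  \int[iid (normal_prob (0 : R) 1) n]_t f (row_of_tuple t).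
Proof.
move=> mf f0; rewrite /std_gaussian /distribution ge0_integral_pushforward//.
Qed.

(** The density ratio is written with squared norms, so that the weights telescope when several maps
    are composed. *)
Lemma cameron_martin n (h : 'rV[R]_n) (f : 'rV[R]_n -> \bar R) :
  measurable_fun setT f -> (forall x, 0 <= f x) ->
  \int[std_gaussian R n]_x
    (f (x + h)%R * (expR ((dotv x x - dotv (x + h) (x + h)) / 2))%:E) =
  \int[std_gaussian R n]_x f x.
Proof.
move=> mf f0; rewrite !ge0_integral_std_gaussian//; last 2 first.
- apply: emeasurable_funM.
    by apply: (measurableT_comp mf); exact: measurable_rvD.
  apply: measurable_expR_fun; apply: measurable_funM => //.
  by apply: measurable_funB; apply: measurable_dotv => //; exact: measurable_rvD.
- by move=> x; apply: mule_ge0 => //; rewrite lee_fin expR_ge0.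
have mfr : measurable_fun setT (f \o @row_of_tuple R n).
  by apply: (measurableT_comp mf); exact: measurable_row_of_tuple.
rewrite -[RHS](iid_normal_translation (fun i => h ord0 i) mfr);
  last by move=> t; exact: f0.
apply: eq_integral => t _ /=; congr (f _ * (expR _)%:E).
  by apply/rowP => i; rewrite !mxE tnth_mktuple.
rewrite !dotvDl !dotvDr (dotvC h (row_of_tuple t)).
rewrite (_ : _ / 2 = - dotv (row_of_tuple t) h - dotv h h / 2)%R; last by field.
rewrite /dotv mulr_suml -!sumrN -big_split /=; apply: eq_bigr => i _.
by rewrite !mxE expr2.
Qed.

End gaussian_translation.

(** * Rotation invariance of the Gaussian measure, by shears *)

Section gaussian_rotation.
Context {R : realType} {n m : nat}.
Local Open Scope ereal_scope.
Implicit Types (F : 'rV[R]_n * 'rV[R]_m -> \bar R)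
  (S : 'rV[R]_n * 'rV[R]_m -> 'rV[R]_n * 'rV[R]_m).

Local Notation gauss2 := (std_gaussian R n \x std_gaussian R m).

Definition sqn2 (z : 'rV[R]_n * 'rV[R]_m) : R :=
  (dotv z.1 z.1 + dotv z.2 z.2)%R.

(* [S] preserves Lebesgue measure, expressed through the Gaussian density. *)
Definition unimodular S := measurable_fun setT S /\
  forall F, measurable_fun setT F -> (forall z, 0 <= F z) ->
    \int[gauss2]_z (F (S z) * (expR ((sqn2 z - sqn2 (S z)) / 2))%:E) =
    \int[gauss2]_z F z.

Lemma measurable_sqn2 d (T : measurableType d)
    (f : T -> 'rV[R]_n * 'rV[R]_m) :
  measurable_fun setT f -> measurable_fun setT (fun z => sqn2 (f z)).
Proof.
move=> mf; apply: measurable_funD; apply: measurable_dotv;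
  exact: measurableT_comp.
Qed.

Lemma measurable_density d (T : measurableType d)
    (f g : T -> 'rV[R]_n * 'rV[R]_m) :
  measurable_fun setT f -> measurable_fun setT g ->
  measurable_fun setT (fun z => (expR ((sqn2 (f z) - sqn2 (g z)) / 2))%:E).
Proof.
move=> mf mg; apply: measurable_expR_fun; apply: measurable_funM => //.
by apply: measurable_funB; exact: measurable_sqn2.
Qed.

Lemma unimodular_comp S S' :
  unimodular S -> unimodular S' -> unimodular (S \o S').
Proof.
move=> [mS uS] [mS' uS']; split; first exact: measurableT_comp.
move=> F mF F0; rewrite -(uS _ mF F0).
rewrite -(uS' (fun z => F (S z) * (expR ((sqn2 z - sqn2 (S z)) / 2))%:E));
    last 2 first.
- apply: emeasurable_funM; first exact: (measurableT_comp mF).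
  exact: measurable_density.
- by move=> z; rewrite mule_ge0// lee_fin expR_ge0.
apply: eq_integral => z _ /=; rewrite -muleA -EFinM -expRD.
by congr (_ * (expR _)%:E); field.
Qed.

Lemma unimodular_isometry S F : unimodular S -> (forall z, sqn2 (S z) = sqn2 z) ->
  measurable_fun setT F -> (forall z, 0 <= F z) ->
  \int[gauss2]_z F (S z) = \int[gauss2]_z F z.
Proof.
move=> [mS uS] iS mF F0; rewrite -(uS _ mF F0).
by apply: eq_integral => z _; rewrite iS subrr mul0r expR0 mule1.
Qed.

(** For a fixed second component a shear is a translation of the first one, so Fubini reduces the
    claim to [cameron_martin]. *)
Lemma unimodular_shear1 (h : 'rV[R]_m -> 'rV[R]_n) : measurable_fun setT h ->
  unimodular (fun z => (z.1 + h z.2, z.2)%R).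
Proof.
move=> mh.
have mS : measurable_fun setT (fun z : 'rV[R]_n * 'rV[R]_m =>
    (z.1 + h z.2, z.2)%R).
  apply: measurable_fun_pair => //=.
  by apply: measurable_rvD => //; exact: measurableT_comp.
split=> [//|F mF F0].
rewrite fubini_tonelli2; last 2 first.
- apply: emeasurable_funM; first exact: (measurableT_comp mF).
  exact: measurable_density.
- by move=> z; rewrite mule_ge0// lee_fin expR_ge0.
rewrite (fubini_tonelli2 _ mF F0); apply: eq_integral => y _.
rewrite /fubini_G -(cameron_martin (h y) (f := fun x => F (x, y)));
  last 2 first.
- by apply: (measurableT_comp mF); exact: measurable_pair2.
- by move=> x; exact: F0.
apply: eq_integral => x _ /=; congr (_ * (expR (_ / 2))%:E).
by rewrite /sqn2/=; ring.
Qed.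

Lemma unimodular_shear2 (h : 'rV[R]_n -> 'rV[R]_m) : measurable_fun setT h ->
  unimodular (fun z => (z.1, z.2 + h z.1)%R).
Proof.
move=> mh.
have mS : measurable_fun setT (fun z : 'rV[R]_n * 'rV[R]_m =>
    (z.1, z.2 + h z.1)%R).
  apply: measurable_fun_pair => //=.
  by apply: measurable_rvD => //; exact: measurableT_comp.
split=> [//|F mF F0].
rewrite fubini_tonelli1; last 2 first.
- apply: emeasurable_funM; first exact: (measurableT_comp mF).
  exact: measurable_density.
- by move=> z; rewrite mule_ge0// lee_fin expR_ge0.
rewrite (fubini_tonelli1 _ mF F0); apply: eq_integral => x _.
rewrite /fubini_F -(cameron_martin (h x) (f := fun y => F (x, y)));
  last 2 first.
- by apply: (measurableT_comp mF); exact: measurable_pair1.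
- by move=> y; exact: F0.
apply: eq_integral => y _ /=; congr (_ * (expR (_ / 2))%:E).
by rewrite /sqn2/=; ring.
Qed.

(* With [B B^T = al I], [al = tan^2 (t / 2)] and [k sqrt al = sin t], the map is
   the rotation by angle [t] of the plane spanned by [y] and its image [y B]; it
   is the product of three shears. *)
Lemma std_gaussian_rotation (B : 'M[R]_(m, n)) (al k : R) F :
  B *m B^T = al%:M -> (k * (1 + al) = 2)%R ->
  measurable_fun setT F -> (forall z, 0 <= F z) ->
  \int[gauss2]_z F (z.1 - k *: (z.1 *m B^T *m B) + k *: (z.2 *m B),
                    (1 - k * al) *: z.2 - k *: (z.1 *m B^T))%R =
  \int[gauss2]_z F z.
Proof.
move=> BB kal mF F0.
have k0 : k != 0%R by apply/eqP => k0; move: kal; rewrite k0; lra.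
have alE : (al = 2 / k - 1)%R.
  by rewrite -kal mulrAC mulfV// mul1r addrAC subrr add0r.
pose S1 z : 'rV[R]_n * 'rV[R]_m := (z.1 + z.2 *m B, z.2)%R.
pose S2 z : 'rV[R]_n * 'rV[R]_m := (z.1, z.2 + - k *: (z.1 *m B^T))%R.
have uS1 : unimodular S1.
  by apply: (@unimodular_shear1 (fun y => y *m B)); exact: measurable_rvM.
have uS2 : unimodular S2.
  apply: (@unimodular_shear2 (fun x => - k *: (x *m B^T))%R).
  by apply: measurable_rvZ => //; exact: measurable_rvM.
have SE z : (S1 \o (S2 \o S1)) z =
    (z.1 - k *: (z.1 *m B^T *m B) + k *: (z.2 *m B),
     (1 - k * al) *: z.2 - k *: (z.1 *m B^T))%R.
  rewrite /S1 /S2/= mulmxDl -mulmxA BB mul_mx_scalar; congr pair.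
    rewrite mulmxDl -!scalemxAl mulmxDl -scalemxAl.
    move: (z.2 *m B) (z.1 *m B^T *m B) z.1 => a b x; apply/rowP => i.
    by rewrite !mxE alE; field.
  move: (z.1 *m B^T) z.2 => b y; apply/rowP => i.
  by rewrite !mxE; ring.
under eq_integral do rewrite -SE.
have uS := unimodular_comp uS1 (unimodular_comp uS2 uS1).
(* A unimodular map that preserves [sqn2] has density ratio 1, so it preserves the Gaussian
   measure. *)
suff iS z : sqn2 ((S1 \o (S2 \o S1)) z) = sqn2 z.
  exact: (unimodular_isometry uS iS mF F0).
rewrite SE /sqn2 /=; set x := z.1; set y := z.2.
set u := x *m B^T.
have e1 (a b : 'rV[R]_m) : dotv (a *m B) (b *m B) = (al * dotv a b)%R.
  by rewrite dotv_mulmx -mulmxA BB mul_mx_scalar dotvZr.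
have e2 (a : 'rV[R]_m) : dotv (a *m B) x = dotv a u by rewrite dotv_mulmx.
rewrite !(dotvDl, dotvDr, dotvNl, dotvNr, dotvZl, dotvZr) !e1.
rewrite !(dotvC x (_ *m B)) !e2 (dotvC y u).
move: (dotv x x) (dotv y y) (dotv u u) (dotv u y) => a b c e.
clear -alE k0; rewrite alE; move: k k0 {alE} => l l0.
by field.
Qed.

End gaussian_rotation.

(** * Gaussian symmetry, autoregressive steps and moment generating function *)

Section gaussian_consequences.
Context {R : realType}.
Local Open Scope ereal_scope.

Lemma ge0_integral_product_fst d1 d2 (T1 : measurableType d1)
    (T2 : measurableType d2) (P : probability T1 R) (Q : probability T2 R)
    (f : T1 -> \bar R) :
  measurable_fun setT f -> (forall x, 0 <= f x) ->
  \int[P \x Q]_z f z.1 = \int[P]_x f x.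
Proof.
move=> mf f0.
have mf1 : measurable_fun setT (fun z : T1 * T2 => f z.1).
  exact: (measurableT_comp mf).
rewrite (fubini_tonelli1 _ mf1 (fun z => f0 z.1)).
apply: eq_integral => x _; rewrite /fubini_F/= integral_cst//.
by rewrite [X in _ * X]probability_setT mule1.
Qed.

Lemma ge0_integral_product_snd d1 d2 (T1 : measurableType d1)
    (T2 : measurableType d2) (P : probability T1 R) (Q : probability T2 R)
    (f : T2 -> \bar R) :
  measurable_fun setT f -> (forall x, 0 <= f x) ->
  \int[P \x Q]_z f z.2 = \int[Q]_x f x.
Proof.
move=> mf f0.
have mf1 : measurable_fun setT (fun z : T1 * T2 => f z.2).
  exact: (measurableT_comp mf).
rewrite (fubini_tonelli2 _ mf1 (fun z => f0 z.2)).
apply: eq_integral => x _; rewrite /fubini_G/= integral_cst//.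
by rewrite [X in _ * X]probability_setT mule1.
Qed.

(** The quarter turn sending [(x, y)] to [(y, - x)] is the rotation with [B = 1%:M] and
    [k = al = 1]; its second component gives the symmetry. *)
Lemma std_gaussianN n (f : 'rV[R]_n -> \bar R) :
  measurable_fun setT f -> (forall x, 0 <= f x) ->
  \int[std_gaussian R n]_x f (- x)%R = \int[std_gaussian R n]_x f x.
Proof.
move=> mf f0.
have mfN : measurable_fun setT (fun x : 'rV[R]_n => f (- x)%R).
  by apply: (measurableT_comp mf); exact: measurable_rvN.
rewrite -(ge0_integral_product_fst (std_gaussian R n) (std_gaussian R n)
  mfN (fun x => f0 (- x)%R)).
rewrite -(ge0_integral_product_snd (std_gaussian R n) (std_gaussian R n) mf f0).
have mf2 : measurable_fun setT (fun z : 'rV[R]_n * 'rV[R]_n => f z.2).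
  exact: (measurableT_comp mf).
have BB : (1%:M : 'M[R]_n) *m (1%:M)^T = 1%:M by rewrite trmx1 mul1mx.
have kal : (1 * (1 + 1) = 2 :> R)%R by rewrite mul1r.
rewrite -(std_gaussian_rotation BB kal mf2 (fun z => f0 z.2)).
apply: eq_integral => z _ /=; congr f.
by rewrite mulr1 subrr scale0r trmx1 mulmx1 scale1r add0r.
Qed.

(** This is the first component of the rotation that mixes the direction [b] with an independent
    one-dimensional Gaussian: an autoregressive step that leaves the measure invariant. *)
Lemma std_gaussian_rotation1 n (b : 'rV[R]_n) (k : R) (f : 'rV[R]_n -> \bar R) :
  (k * (1 + dotv b b) = 2)%R ->
  measurable_fun setT f -> (forall x, 0 <= f x) ->
  \int[std_gaussian R n]_x \int[std_gaussian R 1]_y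
    f (x - (k * dotv x b) *: b + (k * y ord0 ord0) *: b)%R =
  \int[std_gaussian R n]_x f x.
Proof.
move=> kb mf f0.
rewrite -(ge0_integral_product_fst (std_gaussian R n) (std_gaussian R 1) mf f0).
have mf1 : measurable_fun setT (fun z : 'rV[R]_n * 'rV[R]_1 => f z.1).
  exact: (measurableT_comp mf).
have BB : b *m b^T = (dotv b b)%:M.
  apply/matrixP => i j; rewrite !ord1 !mxE/= mulr1n.
  by apply: eq_bigr => l _; rewrite mxE.
rewrite -(std_gaussian_rotation BB kb mf1 (fun z => f0 z.1)) /=.
have SE z : (z.1 - k *: (z.1 *m b^T *m b) + k *: (z.2 *m b) =
    z.1 - (k * dotv z.1 b) *: b + (k * z.2 ord0 ord0) *: b :> 'rV[R]_n)%R.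
  congr (_ - _ + _)%R; apply/rowP => i.
    rewrite !mxE big_ord1 mulrA; congr (_ * _ * _)%R; rewrite mxE.
    by apply: eq_bigr => l _; rewrite mxE.
  by rewrite !mxE big_ord1 mulrA.
under [RHS]eq_integral do rewrite SE.
rewrite [RHS]fubini_tonelli1//.
apply: (measurableT_comp mf).
have mz2 : measurable_fun setT (fun z : 'rV[R]_n * 'rV[R]_1 => z.2 ord0 ord0).
  exact: (@measurable_fun_coord R _ _ 1).
apply: measurable_rvD; last by apply: measurable_rvZ => //; exact: measurable_funM.
apply: measurable_rvB => //; apply: measurable_rvZ => //.
by apply: measurable_funM => //; exact: measurable_dotv.
Qed.

(** The Cameron-Martin formula for the constant function 1 and the shift [- h]. *)
Lemma std_gaussian_mgf n (h : 'rV[R]_n) :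
  \int[std_gaussian R n]_x (expR (dotv x h))%:E = (expR (dotv h h / 2))%:E.
Proof.
have h1 (x : 'rV[R]_n) : 0 <= cst (1%:E : \bar R) x by rewrite lee_fin.
have mc : measurable_fun setT (cst 1%:E : 'rV[R]_n -> \bar R).
  exact: measurable_cst.
have := cameron_martin (- h) mc h1.
rewrite [RHS]integral_cst//= [X in _ * X]probability_setT mule1 => E.
rewrite -[RHS]mule1 -E -ge0_integralZl//=.
- apply: eq_integral => x _; rewrite mul1e -EFinM -expRD; congr ((expR _)%:E).
  rewrite !(dotvDl, dotvDr, dotvNl, dotvNr) (dotvC h x).
  by move: (dotv x x) (dotv x h) (dotv h h) => p q r; field.
- apply: emeasurable_funM => //; apply: measurable_expR_fun.
  apply: measurable_funM => //; apply: measurable_funB; apply: measurable_dotv => //.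
    by apply: measurable_rvD.
  by apply: measurable_rvD.
Qed.

(** Lets a function be replaced by its even part, to which convexity applies directly. The integral
    may be infinite, hence the final case analysis. *)
Lemma ge0_integral_std_gaussian_sym n (f : 'rV[R]_n -> R) :
  measurable_fun setT f -> (forall x, 0 <= f x)%R ->
  \int[std_gaussian R n]_x ((f x + f (- x)) / 2)%:E =
  \int[std_gaussian R n]_x (f x)%:E.
Proof.
move=> mf f0.
have mfE : measurable_fun setT (fun x => (f x)%:E) by exact/measurable_EFinP.
have fE0 x : 0 <= (f x)%:E by rewrite lee_fin.
have mfN : measurable_fun setT (fun x : 'rV[R]_n => (f (- x)%R)%:E).
  by apply: (measurableT_comp mfE); exact: measurable_rvN.
under eq_integral do rewrite mulrC EFinM EFinD.
rewrite ge0_integralZl//; last 2 first.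
- exact: emeasurable_funD.
- by move=> x _; rewrite adde_ge0.
rewrite ge0_integralD//; have /= -> := std_gaussianN mfE fE0.
have : 0 <= \int[std_gaussian R n]_x (f x)%:E by apply: integral_ge0.
case: (integral _ _ _) => [r _|_|//].
- by rewrite -EFinD -EFinM; congr (_%:E); field.
- by rewrite addye// gt0_muley// lte_fin invr_gt0.
Qed.

End gaussian_consequences.

(** * Convex test functions *)

Section convex_order.
Context {R : realType} {n : nat}.
Implicit Types (f g : 'rV[R]_n -> R) (u v w x y z : 'rV[R]_n).

Definition cvxfun f := forall x y (t : R), 0 <= t -> t <= 1 ->
  f (t *: x + (1 - t) *: y) <= t * f x + (1 - t) * f y.

(** The test functions of the convex order; nonnegativity gives them an integral in the extended
    reals in all cases. *)
Definition cvxmf f :=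
  [/\ cvxfun f, measurable_fun setT f & forall x, 0 <= f x].

Lemma cvxfun_mid f x y : cvxfun f ->
  f (2^-1 *: (x + y)) <= (f x + f y) / 2.
Proof.
move=> cf; have := cf x y 2^-1.
have -> : 1 - 2^-1 = 2^-1 :> R by field.
rewrite -scalerDr -mulrDr mulrC; apply; first by rewrite invr_ge0.
by lra.
Qed.

Definition even_part f z u (r : R) := (f (z + r *: u) + f (z - r *: u)) / 2.

(** As [r] lies between [- s] and [s], the points [z + r *: u] and [z - r *: u] are convex
    combinations of [z + s *: u] and [z - s *: u] with exchanged weights, which add up to the even
    part. *)
Lemma even_part_mono f z u r s : cvxfun f -> `|r| <= `|s| ->
  even_part f z u r <= even_part f z u s.
Proof.
move=> cf rs; have [s0|s0] := eqVneq s 0.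
  by move: rs; rewrite s0 normr0 normr_le0 => /eqP ->.
pose t := (1 + r / s) / 2.
have /andP[l1 l2] : -1 <= r / s <= 1.
  by rewrite -ler_norml normf_div ler_pdivrMr ?normr_gt0// mul1r.
have t0 : 0 <= t by rewrite /t; lra.
have t1 : t <= 1 by rewrite /t; lra.
have e1 : z + r *: u = t *: (z + s *: u) + (1 - t) *: (z - s *: u).
  by apply/rowP => i; rewrite !mxE /t; field.
have e2 : z - r *: u = t *: (z - s *: u) + (1 - t) *: (z + s *: u).
  by apply/rowP => i; rewrite !mxE /t; field.
have h1 := cf (z + s *: u) (z - s *: u) t t0 t1.
have h2 := cf (z - s *: u) (z + s *: u) t t0 t1.
rewrite -e1 in h1; rewrite -e2 in h2; rewrite /even_part.
move: (f _) (f (_ - r *: u)) (f _) (f (_ - s *: u)) h1 h2 => a b c d.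
lra.
Qed.

Lemma even_part_chord f z u t s : cvxfun f -> 0 <= t -> t <= 1 ->
  even_part f z u (t * s) <=
  even_part f z u 0 + t * (even_part f z u s - even_part f z u 0).
Proof.
move=> cf t0 t1; rewrite /even_part scale0r subr0 addr0.
have h1 := cf (z + s *: u) z t t0 t1.
have h2 := cf (z - s *: u) z t t0 t1.
have e1 : t *: (z + s *: u) + (1 - t) *: z = z + (t * s) *: u.
  by apply/rowP => i; rewrite !mxE; ring.
have e2 : t *: (z - s *: u) + (1 - t) *: z = z - (t * s) *: u.
  by apply/rowP => i; rewrite !mxE; ring.
rewrite e1 in h1; rewrite e2 in h2.
move: (f _) (f (_ - (t * s) *: u)) (f z) (f _) (f (_ - s *: u)) h1 h2.
by move=> a b c d e; nra.
Qed.

Local Open Scope ereal_scope.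

(** Jensen's inequality by symmetrization: [0] is the midpoint of [s *: x] and [- (s *: x)]. *)
Lemma cvxmf_gaussian_mean f (s : R) : cvxmf f ->
  (f 0%R)%:E <= \int[std_gaussian R n]_x (f (s *: x))%:E.
Proof.
move=> [cf mf f0].
have ms : measurable_fun setT (fun x : 'rV[R]_n => f (s *: x)%R).
  by apply: (measurableT_comp mf); exact: measurable_rvZ.
rewrite -(ge0_integral_std_gaussian_sym ms (fun x => f0 (s *: x)%R)).
have -> : (f 0%R)%:E = \int[std_gaussian R n]_x (cst (f 0%R)%:E) x.
  by rewrite integral_cst// [X in _ * X]probability_setT mule1.
apply: ge0_le_integral => //.
- by move=> x _; rewrite lee_fin.
- apply/measurable_EFinP; apply: measurable_funM => //; apply: measurable_funD => //.
  by apply: (measurableT_comp ms); exact: measurable_rvN.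
- move=> x _; rewrite lee_fin.
  have := cvxfun_mid (s *: x) (s *: - x) cf.
  by rewrite -scalerDr subrr !scaler0.
Qed.

End convex_order.

(** * Domination of a symmetric coin by Gaussian noise *)

Section gaussian_noise.
Context {R : realType}.
Local Open Scope ereal_scope.

Let far : set 'rV[R]_1 := [set y | 1 <= `|y ord0 ord0| ]%R.

Let mfar : measurable far.
Proof.
rewrite -[far]setTI (_ : far = (fun y : 'rV[R]_1 => `|y ord0 ord0|)%R @^-1`
  `[1%R, +oo[%classic); last first.
  by apply/seteqP; split => y /=; rewrite in_itv/= andbT.
have : measurable_fun setT (fun y : 'rV[R]_1 => `|y ord0 ord0|)%R.
  by apply: measurableT_comp => //; exact: measurable_coord.
by apply => //; exact: measurable_itv.
Qed.

(** A universal constant that measures the spread of a normal variable. The estimates use only that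
    it is positive and at most 1. *)
Definition far_prob : R := fine (std_gaussian R 1 far).

Lemma far_probE : std_gaussian R 1 far = far_prob%:E.
Proof. by rewrite /far_prob fineK// fin_num_measure. Qed.

Lemma far_prob_le1 : (far_prob <= 1)%R.
Proof. by rewrite -lee_fin -far_probE probability_le1. Qed.

(** A shift by 2 sends the interval from -1 to 1 into [far], and the Cameron-Martin weight there is
    at least [exp (- 4)]. If [far] were null, its complement would have measure 1 and the shifted
    integral would be at least [exp (- 4)] instead of 0. *)
Lemma far_prob_gt0 : (0 < far_prob)%R.
Proof.
rewrite lt_neqAle -lee_fin -far_probE measure_ge0 andbT eq_sym.
apply/eqP => q0.
have mI : measurable_fun setT (fun y : 'rV[R]_1 => (\1_far y)%:E : \bar R).
  exact/measurable_EFinP/measurable_indic.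
have I0 (y : 'rV[R]_1) : 0 <= ((\1_far y)%:E : \bar R) by rewrite lee_fin.
have := cameron_martin (const_mx 2%R) mI I0.
rewrite [RHS]integral_indic// setIT [RHS]far_probE q0 => E.
have : (expR (- 4))%:E <= 0%:E :> \bar R.
  rewrite -E.
  have -> : (expR (- 4))%:E =
    \int[std_gaussian R 1]_y ((expR (- 4))%:E * (\1_(~` far) y)%:E) :> \bar R.
    rewrite ge0_integralZl//=; last first.
      exact/measurable_EFinP/measurable_indic/measurableC.
    rewrite integral_indic ?setIT//; last exact: measurableC.
    have := probability_setC (std_gaussian R 1) mfar.
    by rewrite far_probE q0 sube0 => H; rewrite [X in _ * X]H mule1.
  apply: ge0_le_integral => //.
  - apply: emeasurable_funM => //.
    exact/measurable_EFinP/measurable_indic/measurableC.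
  - apply: emeasurable_funM.
      by apply: (measurableT_comp mI); exact: measurable_rvD.
    apply: measurable_expR_fun; apply: measurable_funM => //.
    by apply: measurable_funB; apply: measurable_dotv => //; exact: measurable_rvD.
  - move=> y _; rewrite -!EFinM lee_fin !indicE in_setC.
    case: (boolP (y \in far)) => [_|]; first by rewrite mulr0 mulr_ge0 ?expR_ge0.
    rewrite notin_setE /far/= => /negP; rewrite -ltNge ltr_norml => /andP[y1 y2].
    rewrite mem_set /=; last first.
      rewrite !mxE; rewrite ger0_norm; last by move: y1; lra.
      by move: y1; lra.
    rewrite mulr1 mul1r ler_expR /dotv !big_ord1 !mxE.
    by move: y1 y2; nra.
by rewrite lee_fin leNgt expR_gt0.
Qed.

(** The even part [psi] along [u] is at least [psi 0] everywhere and at least [psi kap] when the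
    noise is at least 1 in absolute value. The mean is therefore at least
    [psi 0 + far_prob * (psi kap - psi 0)], which by convexity is at least [psi 2]. *)
Lemma gaussian_noise_convex n (f : 'rV[R]_n -> R) (z u : 'rV[R]_n) (kap : R) :
  cvxmf f -> (2 <= far_prob * kap)%R ->
  ((f (z + 2 *: u) + f (z - 2 *: u)) / 2)%:E <=
  \int[std_gaussian R 1]_y (f (z + (kap * y ord0 ord0) *: u))%:E.
Proof.
move=> [cf mf f0] kap2.
have q0 := far_prob_gt0; have q1 := far_prob_le1.
have kap0 : (0 < kap)%R by rewrite -(pmulr_rgt0 _ q0); lra.
pose psi := even_part f z u.
have ms : measurable_fun setT
    (fun y : 'rV[R]_1 => f (z + (kap * y ord0 ord0) *: u)%R).
  apply: (measurableT_comp mf); apply: measurable_rvD => //.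
  apply: measurable_rvZ => //; apply: measurable_funM => //.
  exact: measurable_coord.
rewrite -(ge0_integral_std_gaussian_sym ms (fun y => f0 _)).
have psi0 r : (0 <= psi r)%R by rewrite /psi divr_ge0// addr_ge0.
have psi0le r : (psi 0 <= psi r)%R by apply: even_part_mono; rewrite ?normr0.
have pk0 : (0 <= psi kap - psi 0)%R by rewrite subr_ge0.
apply: (@le_trans _ _ (\int[std_gaussian R 1]_y
   ((psi 0)%:E + (psi kap - psi 0)%:E * (\1_far y)%:E))).
  rewrite ge0_integralD//; last 3 first.
  - by move=> y _; rewrite lee_fin.
  - by move=> y _; rewrite mule_ge0// lee_fin.
  - apply: emeasurable_funM => //.
    exact/measurable_EFinP/measurable_indic.
  rewrite ge0_integralZl//=; last exact/measurable_EFinP/measurable_indic.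
  rewrite integral_indic ?setIT// [X in _ + _ * X]far_probE.
  rewrite integral_cst// [X in _ * X + _]probability_setT mule1.
  rewrite -EFinM -EFinD lee_fin.
  (* Since [far_prob <= 1], the assumption gives [2 <= kap], so the chord from [0] to [kap] covers
     [2]. *)
  apply: (@le_trans _ _ (psi 0 + 2 / kap * (psi kap - psi 0))%R).
    have := @even_part_chord _ _ f z u (2 / kap)%R kap cf.
    rewrite divfK ?gt_eqF//; apply; first by rewrite divr_ge0// ltW.
    by rewrite ler_pdivrMr// mul1r; nra.
  rewrite lerD2l mulrC ler_wpM2l// ler_pdivrMr//.
apply: ge0_le_integral => //.
- by move=> y _; rewrite -EFinM -EFinD lee_fin addr_ge0// mulr_ge0.
- apply: emeasurable_funD => //; apply: emeasurable_funM => //.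
  exact/measurable_EFinP/measurable_indic.
- apply/measurable_EFinP; apply: measurable_funM => //; apply: measurable_funD => //.
  by apply: (measurableT_comp ms); exact: measurable_rvN.
- move=> y _; rewrite -EFinM -EFinD lee_fin.
  have -> : ((f (z + (kap * y ord0 ord0) *: u) +
     f (z + (kap * (- y) ord0 ord0) *: u)) / 2 = psi (kap * y ord0 ord0))%R.
    by rewrite /psi /even_part mxE mulrN scaleNr.
  rewrite indicE; case: (boolP (y \in far)) => [|_]; last first.
    by rewrite mulr0 addr0.
  rewrite inE /far/= => y1; rewrite mulr1 addrC subrK.
  by apply: even_part_mono => //; rewrite normrM ler_peMr.
Qed.

End gaussian_noise.

(** * One step of the walk against the Gaussian measure *)

Section walk_step.
Context {R : realType} {n : nat}.
Implicit Types (f g : 'rV[R]_n -> R) (u v w x y z : 'rV[R]_n).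

Definition drift (c : R) v w := w - (dotv w v / c) *: v.

(** The average of [f] over the true step has weights that depend on [w] and need not be convex in
    [w]. This symmetric surrogate is convex for convex [f], so it can be iterated. *)
Definition spread (c : R) v f w :=
  (f (drift c v w + 2 *: v) + f (drift c v w - 2 *: v)) / 2.

Lemma driftP c v x y t : drift c v (t *: x + (1 - t) *: y) =
  t *: drift c v x + (1 - t) *: drift c v y.
Proof.
rewrite /drift dotvDl !dotvZl; move: (dotv x v) (dotv y v) => a b.
by apply/rowP => i; rewrite !mxE; ring.
Qed.

Lemma cvxmf_spread c v f : cvxmf f -> cvxmf (spread c v f).
Proof.
move=> [cf mf f0]; split.
- move=> x y t t0 t1; rewrite /spread driftP.
  set a := drift c v x; set b := drift c v y.
  have h1 := cf (a + 2 *: v) (b + 2 *: v) t t0 t1.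
  have h2 := cf (a - 2 *: v) (b - 2 *: v) t t0 t1.
  have e1 : t *: (a + 2 *: v) + (1 - t) *: (b + 2 *: v) =
    t *: a + (1 - t) *: b + 2 *: v by apply/rowP => i; rewrite !mxE; ring.
  have e2 : t *: (a - 2 *: v) + (1 - t) *: (b - 2 *: v) =
    t *: a + (1 - t) *: b - 2 *: v by apply/rowP => i; rewrite !mxE; ring.
  rewrite e1 in h1; rewrite e2 in h2.
  move: (f _) (f (_ - _)) (f _) (f (_ - _)) (f _) (f (_ - _)) h1 h2.
  by move=> ? ? ? ? ? ?; lra.
- have md : measurable_fun setT (drift c v).
    apply: measurable_rvB => //; apply: measurable_rvZ => //.
    by apply: measurable_funM => //; exact: measurable_dotv.
  apply: measurable_funM => //; apply: measurable_funD; apply: (measurableT_comp mf).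
    exact: measurable_rvD.
  exact: measurable_rvB.
- by move=> x; rewrite divr_ge0// addr_ge0.
Qed.

(* The two possible moves average to [drift c v w] and deviate from it by at
   most [2] multiples of [v]. *)
Lemma walk_step_spread c v f w : cvxfun f -> 0 < c -> `|dotv w v| <= c ->
  (2^-1 - dotv w v / (2 * c)) * f (w + v) +
  (1 - (2^-1 - dotv w v / (2 * c))) * f (w - v) <= spread c v f w.
Proof.
move=> cf c0 wv.
rewrite /spread /drift.
pose m := dotv w v / c.
have /andP[m0 m1] : -1 <= m <= 1.
  by rewrite -ler_norml normf_div (gtr0_norm c0) ler_pdivrMr// mul1r.
have -> : dotv w v / (2 * c) = m / 2 by rewrite /m; field; rewrite gt_eqF.
rewrite -/m; set P := w - _ + _; set Q := w - _ - _.
have e1 : w + v = ((3 + m) / 4) *: P + (1 - (3 + m) / 4) *: Q.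
  by rewrite /P /Q; apply/rowP => i; rewrite !mxE; field.
have e2 : w - v = ((1 + m) / 4) *: P + (1 - (1 + m) / 4) *: Q.
  by rewrite /P /Q; apply/rowP => i; rewrite !mxE; field.
have h1 := cf P Q ((3 + m) / 4); rewrite -e1 in h1.
have h2 := cf P Q ((1 + m) / 4); rewrite -e2 in h2.
have {}h1 : f (w + v) <= (3 + m) / 4 * f P + (1 - (3 + m) / 4) * f Q.
  by apply: h1; lra.
have {}h2 : f (w - v) <= (1 + m) / 4 * f P + (1 - (1 + m) / 4) * f Q.
  by apply: h2; lra.
have p0 : 0 <= 2^-1 - m / 2 by lra.
have p1 : 0 <= 1 - (2^-1 - m / 2) by lra.
have := ler_wpM2l p0 h1; have := ler_wpM2l p1 h2.
move: (f _) (f (w - v)) (f _) (f _) => a b d e k1 k2.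
by nra.
Qed.

(** The rotation in the direction [tau *: v] is an autoregressive step whose drift is exactly
    [drift c v]. At standard deviation [2 / far_prob * sqrt c] its noise along [v] is strong enough
    to dominate the coin of size 2. *)
Lemma integral_spread_le c v f : cvxmf f -> 1 <= c -> dotv v v <= 1 ->
  (\int[std_gaussian R n]_x
     (spread c v f ((2 / @far_prob R * Num.sqrt c) *: x))%:E <=
   \int[std_gaussian R n]_x (f ((2 / @far_prob R * Num.sqrt c) *: x))%:E)%E.
Proof.
move=> cmf c1 v1; have [cf mf f0] := cmf.
have [_ ms s0] := cvxmf_spread c v cmf.
set sg := _ / _ * _; set q := @far_prob R.
have qgt0 : 0 < q := far_prob_gt0.
have c0 : 0 < c by apply: lt_le_trans c1.
have v0 := dotv_ge0 v.
have tpos : 0 < 2 * c - dotv v v by lra.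
(* [tau] solves the two requirements [k * (1 + tau^2 |v|^2) = 2], for a rotation, and
   [k * tau^2 = 1 / c], for the drift. *)
pose tau := (Num.sqrt (2 * c - dotv v v))^-1.
have tau0 : 0 < tau by rewrite invr_gt0 sqrtr_gt0.
have tau2 : tau ^+ 2 * (2 * c - dotv v v) = 1.
  by rewrite exprVn sqr_sqrtr ?ltW// mulVf// gt_eqF.
have mfs : measurable_fun setT (fun x : 'rV[R]_n => (f (sg *: x))%:E).
  apply/measurable_EFinP; apply: (measurableT_comp mf).
  exact: measurable_rvZ.
pose k := (c * tau ^+ 2)^-1.
have ct0 : 0 < c * tau ^+ 2 by rewrite mulr_gt0// exprn_gt0.
have kb : k * (1 + dotv (tau *: v) (tau *: v)) = 2.
  rewrite dotvZl dotvZr mulrA -expr2.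
  have -> : 1 + tau ^+ 2 * dotv v v = 2 * (c * tau ^+ 2).
    by move: (dotv v v) (tau ^+ 2) tau2 => D t2; nra.
  by rewrite /k mulrCA mulVf ?mulr1// gt_eqF.
have fs0 x : (0 <= (f (sg *: x))%:E)%E by rewrite lee_fin.
(* By invariance the right-hand side becomes a double integral, and the inner integral over the
   noise is compared pointwise in [x]. *)
rewrite -[leRHS](std_gaussian_rotation1 kb mfs fs0).
apply: ge0_le_integral => //.
- by move=> x _; rewrite lee_fin.
- by apply/measurable_EFinP; apply: (measurableT_comp ms); exact: measurable_rvZ.
- apply: (@measurable_fun_fubini_tonelli_F _ _ _ _ _ _
    (fun z : 'rV[R]_n * 'rV[R]_1 => (f (sg *: (z.1 - (k * dotv z.1 (tau *: v))
       *: (tau *: v) + (k * z.2 ord0 ord0) *: (tau *: v))))%:E)); last first.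
    by move=> z; rewrite lee_fin.
  apply: (measurableT_comp mfs).
  have mz2 : measurable_fun setT (fun z : 'rV[R]_n * 'rV[R]_1 => z.2 ord0 ord0).
    exact: (@measurable_fun_coord R _ _ 1).
  apply: measurable_rvD; last by apply: measurable_rvZ => //; exact: measurable_funM.
  apply: measurable_rvB => //; apply: measurable_rvZ => //.
  by apply: measurable_funM => //; exact: measurable_dotv.
move=> x _.
have kt : k * tau ^+ 2 = c^-1 by rewrite /k; field; rewrite !gt_eqF.
have step (r : R) : sg *: (x - (k * dotv x (tau *: v)) *: (tau *: v) +
      (k * r) *: (tau *: v)) = drift c v (sg *: x) + (sg * k * tau * r) *: v.
  rewrite /drift dotvZr dotvZl -kt; move: (dotv x v) => a.
  by apply/rowP => i; rewrite !mxE; ring.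
under eq_integral do rewrite step.
apply: gaussian_noise_convex => //.
(* The noise suffices once [c * tau^2 <= 1], which amounts to [|v|^2 <= c]. *)
have -> : q * (sg * k * tau) = 2 * (Num.sqrt c * (k * tau)).
  by rewrite /sg -/q; field; rewrite gt_eqF.
rewrite ler_peMr//.
have -> : k * tau = (c * tau)^-1 by rewrite /k; field; rewrite !gt_eqF.
rewrite ler_pdivlMr ?mulr_gt0// mul1r.
have sc0 : 0 < Num.sqrt c by rewrite sqrtr_gt0.
rewrite -[X in X * _](sqr_sqrtr (ltW c0)) expr2 -mulrA ger_pMr//.
rewrite /tau ler_pdivrMr ?sqrtr_gt0// mul1r ler_sqrt//; lra.
Qed.

End walk_step.

(** * Open and closed sets are measurable *)

Section borel_row_vectors.
Context {R : realType} {n : nat}.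

(** An open set is the union of the sup-norm boxes with rational centre and radius [1 / (k + 1)]
    that it contains, and there are countably many such boxes. *)
Lemma open_rv_measurable (U : set 'rV[R]_n) : open U -> measurable U.
Proof.
move=> oU.
pose box (qk : {ffun 'I_n -> rat} * nat) : set 'rV[R]_n :=
  [set x | forall i, `|x ord0 i - ratr (qk.1 i)| < qk.2.+1%:R^-1].
have mbox qk : measurable (box qk).
  rewrite (_ : box qk = \bigcap_(i in [set: 'I_n])
    ((fun x : 'rV[R]_n => `|x ord0 i - ratr (qk.1 i)|) @^-1`
       `]-oo, (qk.2.+1%:R^-1 : R)[%classic)); last first.
    apply/seteqP; split=> x /= h i; first by move=> _ /=; rewrite in_itv/=; exact: h.
    by have := h i I; rewrite /= in_itv.
  apply: fin_bigcap_measurable => // i _; rewrite -[X in measurable X]setTI.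
  have : measurable_fun setT (fun x : 'rV[R]_n => `|x ord0 i - ratr (qk.1 i)|).
    apply: measurableT_comp => //; apply: measurable_funB => //.
    exact: measurable_coord.
  by apply => //; exact: measurable_itv.
(* Boxes not contained in [U] are replaced by [set0], so that the union runs over the whole
   countable index type. *)
pose F qk := if `[< box qk `<=` U >] then box qk else set0.
have -> : U = \bigcup_qk F qk.
  apply/seteqP; split=> x; last first.
    by move=> [qk _]; rewrite /F; case: asboolP => // bU /bU.
  move=> Ux; have /nbhs_ballP[e /= e0 xeU] : nbhs x U by exact: open_nbhs_nbhs.
  have e20 : 0 < e / 2 by rewrite divr_gt0.
  pose k := Num.truncn (e / 2)^-1.
  have ke : k.+1%:R^-1 < e / 2.
    by rewrite invf_plt ?posrE// truncnS_gt.
  have k0 : 0 < k.+1%:R^-1 :> R by rewrite invr_gt0.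
  have hq i : exists q : rat, `|x ord0 i - ratr q| < k.+1%:R^-1.
    have /rat_in_itvoo[q] : x ord0 i - k.+1%:R^-1 < x ord0 i + k.+1%:R^-1.
      by rewrite ltrD2l gtrN.
    rewrite in_itv/= => /andP[q1 q2]; exists q.
    by rewrite ltr_distlC q1 q2.
  have [q hq'] := choice hq.
  exists ([ffun i => q i], k) => //.
  have xb : box ([ffun i => q i], k) x by move=> i /=; rewrite ffunE.
  rewrite /F; case: asboolP => // -[] y yb; apply: xeU; split => // i j.
  rewrite !ord1 /ball/=; have := yb j; have := xb j; rewrite /= => h1 h2.
  rewrite (_ : x _ _ - y _ _ = x ord0 j - ratr ([ffun i => q i] j)
     - (y ord0 j - ratr ([ffun i => q i] j))); last by ring.
  apply: le_lt_trans (ler_normB _ _) _.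
  by rewrite [ltRHS](splitr e) ltrD// (lt_trans _ ke).
apply: countable_bigcupT_measurable => [|qk]; first exact: countableP.
by rewrite /F; case: ifP.
Qed.

Lemma closed_rv_measurable (U : set 'rV[R]_n) : closed U -> measurable U.
Proof.
by move=> cU; rewrite -[U]setCK; apply: measurableC; apply: open_rv_measurable;
  exact: closed_openC.
Qed.

End borel_row_vectors.

(** * Fernique's theorem for a seminorm *)

Section fernique.
Context {R : realType} {n : nat} (N : 'rV[R]_n -> R).
Hypothesis mN : measurable_fun setT N.
Hypothesis ND : forall x y, N (x + y) <= N x + N y.
Hypothesis NZ : forall (t : R) x, 0 <= t -> N (t *: x) = t * N x.
Hypothesis NN : forall x, N (- x) = N x.
Local Open Scope ereal_scope.

Let gam := std_gaussian R n.
Let tail (b : R) : set 'rV[R]_n := [set x | b < N x]%R.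

Hypothesis gam_unit : (2^-1)%:E <= gam [set x | N x <= 1]%R.

Let mtail b : measurable (tail b).
Proof.
rewrite -[tail b]setTI (_ : tail b = N @^-1` `]b, +oo[%classic); last first.
  by apply/seteqP; split => y /=; rewrite in_itv/= andbT.
by apply: mN => //; exact: measurable_itv.
Qed.

Let unit_tail : [set x | N x <= 1]%R = ~` tail 1.
Proof.
by apply/seteqP; split => x /=; rewrite /tail/= leNgt => /negP.
Qed.

Let triangle_rot (x y : 'rV[R]_n) (s t : R) : (0 <= s)%R -> (0 <= t)%R ->
  (s * N x - t * N y <= N (s *: x + t *: y))%R /\
  (s * N x - t * N y <= N (s *: x - t *: y))%R.
Proof.
move=> s0 t0; have h1 := ND (s *: x + t *: y) (- (t *: y)).
have h2 := ND (s *: x - t *: y) (t *: y).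
rewrite NN addrK !NZ// in h1; rewrite subrK !NZ// in h2.
by split; rewrite lerBlDr.
Qed.

(* Rotate [(x, y)] by the angle with cosine 3/5. The two disjoint events
   [N x <= 1 < b < N y] and [N y <= 1 < b < N x] both force the two rotated
   vectors into the tail; having both of them compensates for the factor 1/2
   lost in [gam_unit], so the tail gets squared at each step. *)
Let tail_step b : (1 <= b)%R ->
  gam (tail b) <= gam (tail ((3 * b - 4) / 5)) * gam (tail ((3 * b - 4) / 5)).
Proof.
move=> b1; set b' := (_ / _)%R.
pose A := tail b' `*` tail b'.
have mA : measurable A by apply: measurableX.
pose D := tail b.
pose U := ~` tail 1.
have mU : measurable U by apply: measurableC.
have mD : measurable D := mtail b.
rewrite -(product_measure1E gam gam (mtail b') (mtail b')) -/A.
have EA : (gam \x gam) A = \int[gam \x gam]_z (\1_A z)%:E.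
  by rewrite integral_indic// setIT.
have mI (X : set ('rV[R]_n * 'rV[R]_n)) : measurable X ->
    measurable_fun setT (fun z => (\1_X z)%:E : \bar R).
  by move=> mX; exact/measurable_EFinP/measurable_indic.
(* The value [1/4] is the squared tangent of half the angle: the cosine is
   [(1 - 1/4) / (1 + 1/4) = 3/5], and [k = 2 / (1 + 1/4) = 8/5]. *)
have BB : ((2^-1)%:M : 'M[R]_n) *m ((2^-1)%:M)^T = (4^-1)%:M.
  rewrite tr_scalar_mx -scalar_mxM; congr (_%:M).
  by field.
have kal : (8 / 5 * (1 + 4^-1) = 2 :> R)%R by field.
have IA0 z : 0 <= (\1_A z)%:E :> \bar R by rewrite lee_fin.
rewrite EA -(std_gaussian_rotation BB kal (mI A mA) IA0).
have rotE (x y : 'rV[R]_n) : ((x - (8 / 5) *: (x *m ((2^-1)%:M)^T *m (2^-1)%:M)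
    + (8 / 5) *: (y *m (2^-1)%:M))%R, ((1 - 8 / 5 * 4^-1) *: y
    - (8 / 5) *: (x *m ((2^-1)%:M)^T))%R) =
    (((3 / 5) *: x + (4 / 5) *: y)%R, ((3 / 5) *: y - (4 / 5) *: x)%R).
  rewrite !tr_scalar_mx !mul_mx_scalar; congr pair;
    by apply/rowP => i; rewrite !mxE; field.
apply: (@le_trans _ _ (\int[gam \x gam]_z
   ((\1_(U `*` D) z)%:E + (\1_(D `*` U) z)%:E))).
  rewrite ge0_integralD//; last 2 first.
  - by apply: mI; exact: measurableX.
  - by apply: mI; exact: measurableX.
  rewrite !integral_indic ?setIT//; [|exact: measurableX|exact: measurableX].
  rewrite [X in _ <= X + _](product_measure1E gam gam mU mD).
  rewrite [X in _ <= _ + X](product_measure1E gam gam mD mU).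
  rewrite [X in _ <= _ + X]muleC -ge0_muleDl//.
  rewrite -[leLHS]mul1e; apply: lee_wpmul2r => //.
  have -> : 1 = (2^-1)%:E + (2^-1)%:E :> \bar R.
    by rewrite -EFinD; congr (_%:E); field.
  by rewrite /U -unit_tail leeD.
apply: ge0_le_integral => //.
- by move=> z _; rewrite -EFinD lee_fin addr_ge0.
- by apply: emeasurable_funD; apply: mI; exact: measurableX.
- apply: (measurableT_comp (mI A mA)).
  apply: measurable_fun_pair => /=.
    apply: measurable_rvD; last by apply: measurable_rvZ => //; exact: measurable_rvM.
    apply: measurable_rvB => //; apply: measurable_rvZ => //.
    by do 2 apply: measurable_rvM.
  apply: measurable_rvB; apply: measurable_rvZ => //.
  exact: measurable_rvM.
move=> [x y] _; rewrite /= rotE -EFinD lee_fin !indicE.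
have [H|H] := pselect (((U `*` D) (x, y)) \/ ((D `*` U) (x, y))); last first.
  have h1 : ~ (U `*` D) (x, y) by move=> h; apply: H; left.
  have h2 : ~ (D `*` U) (x, y) by move=> h; apply: H; right.
  by rewrite (memNset h1) (memNset h2) addr0.
(* In each rotated vector the large seminorm has coefficient at least [3/5] and the small one at
   most [4/5]; the worst case gives the threshold [(3 b - 4) / 5]. *)
have bound : (b' < N ((3 / 5) *: x + (4 / 5) *: y))%R /\
             (b' < N ((3 / 5) *: y - (4 / 5) *: x))%R.
  have s0 : (0 <= 3 / 5 :> R)%R by rewrite divr_ge0.
  have t0 : (0 <= 4 / 5 :> R)%R by rewrite divr_ge0.
  have [h1 _] := triangle_rot x y s0 t0.
  have [h2 _] := triangle_rot y x t0 s0.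
  have [_ h3] := triangle_rot y x s0 t0.
  have [_ h4] := triangle_rot x y t0 s0.
  rewrite [X in (_ <= N X)%R]addrC in h2; rewrite -[X in (_ <= X)%R]NN opprB in h4.
  rewrite /b'; case: H => -[] /=; rewrite /D /U /tail/= => u1 u2.
    move/negP: u1; rewrite -leNgt => u1.
    by split; [move: h2|move: h3]; lra.
  move/negP: u2; rewrite -leNgt => u2.
  by split; [move: h1|move: h4]; lra.
have HA : A (((3 / 5) *: x + (4 / 5) *: y)%R, ((3 / 5) *: y - (4 / 5) *: x)%R).
  exact: bound.
rewrite (mem_set HA).
(* As [1 <= b], the two events are disjoint, so their indicators add up to at most 1. *)
have [/set_mem H1|] := boolP ((x, y) \in U `*` D); last first.
  by rewrite add0r ler_nat leq_b1.
rewrite memNset ?addr0// => -[/= d1 _]; case: H1 => /= u1 _.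
by apply: u1; rewrite /tail/=; apply: le_lt_trans d1.
Qed.

(** For [p = 2^k >= 1] one has [(3 * 8 p - 4) / 5 >= 4 p], so doubling the threshold squares the
    bound through [tail_step]. *)
Let tail_pow k : gam (tail (4 * 2 ^+ k)) <= (2^-1 ^+ (2 ^ k))%:E.
Proof.
elim: k => [|k ih].
  rewrite expr0 mulr1 expn0 expr1.
  apply: (@le_trans _ _ (gam (tail 1))).
    by apply: le_measure; rewrite ?inE// => x; rewrite /tail/=; lra.
  have := probability_setC gam (mtail 1); rewrite -unit_tail => h.
  move: gam_unit; rewrite h.
  have : gam (tail 1) \is a fin_num by rewrite fin_num_measure.
  case: (gam _) => // r _; rewrite -EFinB !lee_fin; lra.
have p1 : (1 <= 2 ^+ k :> R)%R by rewrite exprn_ege1// ler1n.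
apply: le_trans (tail_step _) _.
  by rewrite exprS; lra.
have le1 : gam (tail ((3 * (4 * 2 ^+ k.+1) - 4) / 5)) <= gam (tail (4 * 2 ^+ k)).
  apply: le_measure; rewrite ?inE// => x; rewrite /tail/= exprS.
  by move=> h; move: h p1; move: (2 ^+ k)%R (N x) => p q; lra.
apply: (@le_trans _ _ ((2^-1 ^+ (2 ^ k))%:E * (2^-1 ^+ (2 ^ k))%:E)).
  by apply: lee_pmul => //; exact: le_trans le1 ih.
by rewrite -EFinM -exprD addnn -mul2n expnS.
Qed.

(** Dyadic decomposition: where [N x <= 4] the integrand is at most 2; elsewhere the least [k] with
    [N x <= 8 * 2^k] satisfies [4 * 2^k < N x], so level [k] pays for [x]. By [tail_pow] and
    [2 k <= 2^k], level [k] contributes at most [2^(2^k / 2) * 2^(- 2^k) <= 2^(- k)], and these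
    terms sum to 2. *)
Lemma fernique :
  \int[gam]_x (expR (ln 2 / 16 * N x))%:E <= 4%:E.
Proof.
have ln20 : (0 < ln 2 :> R)%R by rewrite ln_gt0// ltr1n.
pose t (k : nat) (x : 'rV[R]_n) : \bar R :=
  (expR (ln 2 / 2 * 2 ^+ k))%:E * (\1_(tail (4 * 2 ^+ k)) x)%:E.
have t0 k x : 0 <= t k x by rewrite /t -EFinM lee_fin mulr_ge0 ?expR_ge0.
have mt k : measurable_fun setT (t k).
  by apply: emeasurable_funM => //; exact/measurable_EFinP/measurable_indic.
have pw x : (expR (ln 2 / 16 * N x))%:E <= 2%:E + \sum_(k <oo) t k x.
  have s0 : 0 <= \sum_(k <oo) t k x by apply: nneseries_ge0 => k _ _; exact: t0.
  have [N4|N4] := leP (N x) 4%R.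
    apply: (@le_trans _ _ 2%:E); last by rewrite leeDl.
    rewrite lee_fin -[leRHS]lnK ?posrE// ler_expR.
    by move: (N x) N4 (ln 2) ln20 => p h q h'; nra.
  have ex : exists k, (N x <= 8 * 2 ^+ k)%R.
    exists (Num.truncn (N x)).+1.
    apply: ltW; apply: lt_le_trans (truncnS_gt _) _.
    apply: (@le_trans _ _ (2 ^ (Num.truncn (N x)).+1)%:R%R).
      by rewrite ler_nat ltnW// ltn_expl.
    by rewrite natrX ler_peMl// ?exprn_ge0// ler1n.
  have [k hk mink] := ex_minnP ex.
  have lowk : (4 * 2 ^+ k < N x)%R.
    case: k hk mink => [|k] hk mink; first by rewrite expr0 mulr1.
    rewrite exprS mulrA (_ : 4 * 2 = 8)%R; last by rewrite -natrM.
    by rewrite ltNge; apply/negP => /mink; rewrite ltnn.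
  apply: (@le_trans _ _ (t k x)).
    rewrite /t indicE mem_set//= mule1 lee_fin ler_expR.
    by move: hk ln20; move: (N x) (ln 2) (2 ^+ k)%R => p q r; nra.
  apply: (@le_trans _ _ (\sum_(0 <= i < k.+1) t i x)).
    rewrite big_nat_recr//= leeDr// sume_ge0// => i _; exact: t0.
  apply: (@le_trans _ _ (\sum_(k <oo) t k x)); last by rewrite leeDr.
  by apply: nneseries_lim_ge => i _ _; exact: t0.
apply: (@le_trans _ _ (\int[gam]_x (2%:E + \sum_(k <oo) t k x))).
  apply: ge0_le_integral => //.
  - by apply: measurable_expR_fun; apply: measurable_funM.
  - by apply: emeasurable_funD => //; exact: ge0_emeasurable_sum.
rewrite ge0_integralD//; last 2 first.
- by move=> x _; apply: nneseries_ge0 => k _ _; exact: t0.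
- exact: ge0_emeasurable_sum.
rewrite integral_cst// [X in _ * X + _]probability_setT mule1.
rewrite (_ : 4%:E = 2%:E + 2%:E); last by rewrite -EFinD; congr (_%:E); ring.
apply: leeD => //.
rewrite integral_nneseries//.
apply: le_trans (epsilon_trick0 xpredT (ler0n R 2)).
apply: lee_nneseries => [k _ _|k _]; first exact: integral_ge0.
rewrite /t ge0_integralZl//=; last first.
  exact/measurable_EFinP/measurable_indic.
rewrite integral_indic ?setIT//.
apply: (@le_trans _ _ ((expR (ln 2 / 2 * 2 ^+ k))%:E * (2^-1 ^+ (2 ^ k))%:E)).
  apply: lee_wpmul2l; first by rewrite lee_fin expR_ge0.
  exact: tail_pow.
rewrite -EFinM lee_fin.
have e2 : (2^-1 = expR (- ln 2) :> R)%R by rewrite expRN lnK// posrE.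
have -> : (2 / (2 ^ k.+1)%:R = expR (- ln 2 * k%:R) :> R)%R.
  rewrite expRM_natr -e2 natrX exprS invfM mulrA mulfV ?mul1r ?exprVn//.
rewrite [X in (_ * X <= _)%R](_ : _ = expR (- ln 2) ^+ (2 ^ k))%R; last by rewrite -e2.
rewrite -expRM_natr natrX -expRD ler_expR.
have : (2 * k%:R <= 2 ^+ k :> R)%R.
  rewrite -natrX -natrM ler_nat.
  elim: k => [//|[//|k] ih]; rewrite expnS.
  apply: leq_trans (leq_mul (leqnn 2) ih); rewrite leq_mul2l/=.
  by rewrite mul2n -addnn addSn addnS !ltnS leq_addl.
move: (2 ^+ k)%R (k%:R) (ln 2) ln20 => p q l l0; rewrite -subr_ge0 => h.
by have := mulr_ge0 (ltW l0) h; lra.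
Qed.

End fernique.

(** * The Minkowski functional of a symmetric convex body *)

Section gauge.
Context {R : realType} {n : nat} (K : set 'rV[R]_n).
Hypothesis sK : symmetric_convex_body K.
Implicit Types x y : 'rV[R]_n.

Definition gauge x : R := inf [set r | 0 < r /\ K (r^-1 *: x)].

Let K_conv x y (t : R) : 0 <= t -> t <= 1 -> K x -> K y ->
  K (t *: x + (1 - t) *: y).
Proof.
move=> t0 t1 Kx Ky; have [cK _ _ _] := sK.
by have := cK x y (Itv01 t0 t1) (mem_set Kx) (mem_set Ky); rewrite inE.
Qed.

(** For [x0] interior to [K], the point [x] is the midpoint of [x0 + x] and of the reflection of
    [x0 - x], so a ball around [x0] moves to the origin. *)
Let K_ball : exists2 e, 0 < e & forall x, `|x| < e -> K x.
Proof.
have [_ _ [x0 /nbhs_ballP[e /= e0 x0e]] KN] := sK.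
exists e => // x xe.
have h1 : K (x0 + x).
  by apply: x0e; rewrite -ball_normE/= opprD addrA subrr add0r normrN.
have h2 : K (- (x0 - x)).
  by apply/KN/x0e; rewrite -ball_normE/= opprD addrA subrr add0r opprK.
have := @K_conv _ _ 2^-1 _ _ h1 h2.
have -> : 2^-1 *: (x0 + x) + (1 - 2^-1) *: - (x0 - x) = x.
  by apply/rowP => i; rewrite !mxE; field.
by apply; rewrite ?invr_ge0//; lra.
Qed.

Let K0 : K 0.
Proof. by have [e e0 h] := K_ball; apply: h; rewrite normr0. Qed.

Let K_star x (t : R) : 0 <= t -> t <= 1 -> K x -> K (t *: x).
Proof.
by move=> t0 t1 Kx; have := K_conv t0 t1 Kx K0; rewrite scaler0 addr0.
Qed.

Let lbounded x : has_lbound [set r : R | 0 < r /\ K (r^-1 *: x)].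
Proof. by exists 0 => r [/ltW]. Qed.

Lemma gauge_le x (r : R) : 0 < r -> K (r^-1 *: x) -> gauge x <= r.
Proof. by move=> r0 Kx; apply: ge_inf. Qed.

(** The linear bound makes the gauge Lipschitz; nonemptiness makes its infimum genuine, since [inf]
    of the empty set is a default value. *)
Let gauge_norm : exists2 L : R, 0 < L & forall x, gauge x <= L * `|x| /\
  [set r : R | 0 < r /\ K (r^-1 *: x)] !=set0.
Proof.
have [e e0 h] := K_ball; exists (2 / e); first by rewrite divr_gt0.
have e2 : 0 < 2 / e by rewrite divr_gt0.
move=> x; have [->|x0] := eqVneq x 0.
  split; last by exists 1; split; rewrite // scaler0.
  rewrite normr0 mulr0; apply/ler_addgt0Pl => r r0; rewrite addr0.
  by apply: gauge_le => //; rewrite scaler0.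
(* The factor 2 scales [x] to norm [e / 2], strictly inside the ball. *)
have r0 : 0 < 2 / e * `|x| by rewrite mulr_gt0// normr_gt0.
have Kr : K ((2 / e * `|x|)^-1 *: x).
  apply: h; rewrite normrZ gtr0_norm ?invr_gt0// invfM -mulrA mulVf ?normr_eq0//.
  by rewrite mulr1 invf_div ltr_pdivrMr// ltr_pMr// ltr1n.
by split; [exact: gauge_le|exists (2 / e * `|x|)].
Qed.

Lemma gauge_ge0 x : 0 <= gauge x.
Proof.
have [L _ h] := gauge_norm; have [_ ne] := h x.
by apply: lb_le_inf => // r [/ltW].
Qed.

Lemma gauge_lt x (r : R) : gauge x < r -> K (r^-1 *: x).
Proof.
move=> xr; have [L _ h] := gauge_norm; have [_ ne] := h x.
have [s [s0 Ks] sr] : exists2 s, [set r | 0 < r /\ K (r^-1 *: x)] s & s < r.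
  have hinf : has_inf [set r | 0 < r /\ K (r^-1 *: x)] by split.
  have rx0 : 0 < r - gauge x by rewrite subr_gt0.
  have [s Ks sr] := inf_adherent rx0 hinf.
  by exists s => //; move: sr; rewrite -/(gauge x) addrC subrK.
have r0 : 0 < r by exact: lt_trans sr.
have -> : r^-1 *: x = (s / r) *: (s^-1 *: x).
  by rewrite scalerA; congr (_ *: _); field; rewrite !gt_eqF.
by apply: K_star => //; rewrite ?divr_ge0 ?ltW// ltr_pdivrMr// mul1r.
Qed.

Lemma gaugeD x y : gauge (x + y) <= gauge x + gauge y.
Proof.
apply/ler_addgt0Pl => e e0.
have e20 : 0 < e / 2 by rewrite divr_gt0.
have Kx : K ((gauge x + e / 2)^-1 *: x) by apply: gauge_lt; rewrite ltrDl.
have Ky : K ((gauge y + e / 2)^-1 *: y) by apply: gauge_lt; rewrite ltrDl.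
have rx : 0 < gauge x + e / 2 by rewrite ltr_wpDl// gauge_ge0.
have ry : 0 < gauge y + e / 2 by rewrite ltr_wpDl// gauge_ge0.
have -> : e + (gauge x + gauge y) = (gauge x + e / 2) + (gauge y + e / 2) by field.
move: (gauge x + e / 2) (gauge y + e / 2) Kx Ky rx ry => r s Kx Ky r0 s0.
apply: gauge_le; first exact: addr_gt0.
have -> : (r + s)^-1 *: (x + y) =
    (r / (r + s)) *: (r^-1 *: x) + (1 - r / (r + s)) *: (s^-1 *: y).
  by apply/rowP => i; rewrite !mxE; field; rewrite !gt_eqF// addr_gt0.
apply: K_conv => //; first by rewrite divr_ge0 ?addr_ge0// ltW.
by rewrite ler_pdivrMr ?addr_gt0// mul1r lerDl ltW.
Qed.

Let gaugeZ_le x (t : R) : 0 < t -> gauge (t *: x) <= t * gauge x.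
Proof.
move=> t0; apply/ler_addgt0Pl => e e0.
have et : 0 < e / t by rewrite divr_gt0.
have -> : e + t * gauge x = t * (gauge x + e / t) by field; rewrite gt_eqF.
have r0 : 0 < gauge x + e / t by rewrite ltr_wpDl// gauge_ge0.
have Kx : K ((gauge x + e / t)^-1 *: x) by apply: gauge_lt; rewrite ltrDl.
apply: gauge_le; first exact: mulr_gt0.
by rewrite scalerA invfM mulrAC mulVf ?mul1r// gt_eqF.
Qed.

Lemma gaugeZ (t : R) x : 0 <= t -> gauge (t *: x) = t * gauge x.
Proof.
rewrite le_eqVlt => /predU1P[<-|t0].
  rewrite scale0r mul0r; apply/eqP; rewrite eq_le gauge_ge0 andbT.
  apply/ler_addgt0Pl => r r0; rewrite addr0.
  by apply: gauge_le => //; rewrite scaler0.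
apply/eqP; rewrite eq_le gaugeZ_le//=.
have t0' : 0 < t^-1 by rewrite invr_gt0.
have := gaugeZ_le (t *: x) t0'; rewrite scalerA mulVf ?gt_eqF// scale1r.
by rewrite mulrC ler_pdivlMr// mulrC.
Qed.

Lemma gaugeN x : gauge (- x) = gauge x.
Proof.
have [_ _ _ KN] := sK; congr inf; apply/seteqP; split=> r /= [r0 Kr]; split => //.
  by have := KN _ Kr; rewrite -scalerN opprK.
by rewrite scalerN; exact: KN.
Qed.

Lemma gauge_le1 x : K x -> gauge x <= 1.
Proof. by move=> Kx; apply: gauge_le => //; rewrite invr1 scale1r. Qed.

(** Subadditivity and the linear bound of [gauge_norm] make the sets where the gauge exceeds [r]
    open. *)
Lemma measurable_gauge : measurable_fun setT gauge.
Proof.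
apply: (measurability (RGenOInfty.G (R := R)) (RGenOInfty.measurableE R)).
move=> _ [_ [r ->] <-]; rewrite setTI; apply: open_rv_measurable.
rewrite openE => x /=; rewrite in_itv/= andbT => rx.
have [L L0 h] := gauge_norm.
apply/nbhs_ballP; exists ((gauge x - r) / L).
  by rewrite /= divr_gt0// subr_gt0.
move=> y; rewrite -ball_normE /= => xy; rewrite in_itv/= andbT.
have [h1 _] := h (x - y); have h2 := gaugeD (x - y) y.
rewrite subrK in h2; move: xy; rewrite ltr_pdivlMr// mulrC => xy.
by move: h1 h2 xy; lra.
Qed.

Lemma cvxfun_gauge_expR (l : R) : 0 <= l ->
  cvxfun (fun x => expR (l * gauge x)).
Proof.
move=> l0 x y t t0 t1.
have := convex_expR (Itv01 t0 t1) (l * gauge x) (l * gauge y).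
rewrite !convRE /= => h; apply: le_trans h; rewrite ler_expR.
have u0 : 0 <= 1 - t by rewrite subr_ge0.
have := gaugeD (t *: x) ((1 - t) *: y); rewrite !gaugeZ// => h.
by have := ler_wpM2l l0 h; rewrite mulrDr ![l * (_ * gauge _)]mulrCA.
Qed.

Lemma measurable_convex_body : measurable K.
Proof.
have [_ cK _ _] := sK; apply: closed_rv_measurable.
by apply: compact_closed => //; exact: norm_hausdorff.
Qed.

Lemma gauge_fernique : ((2^-1)%:E <= std_gaussian R n K)%E ->
  (\int[std_gaussian R n]_x (expR (ln 2 / 16 * gauge x))%:E <= 4%:E)%E.
Proof.
move=> hK; apply: fernique.
- exact: measurable_gauge.
- exact: gaugeD.
- exact: gaugeZ.
- exact: gaugeN.
apply: le_trans hK _; apply: le_measure; rewrite ?inE.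
- exact: measurable_convex_body.
- rewrite -[X in measurable X]setTI (_ : mkset _ = gauge @^-1` `]-oo, 1]%classic).
    by apply: measurable_gauge => //; exact: measurable_itv.
  by apply/seteqP; split => y /=; rewrite in_itv.
- by move=> x; exact: gauge_le1.
Qed.

End gauge.

(** * The walk as a function of vectors and uniform variables *)

Section walk.
Context {R : realType} {n : nat}.
Implicit Types (u : R) (v w : 'rV[R]_n) (vs : seq 'rV[R]_n).

Definition plus_prob (c : R) w v : R := 2^-1 - dotv w v / (2 * c).

(** For [u] uniform on [[0, 1]] this is the biased step. When [|dotv w v| > c] the threshold leaves
    [[0, 1]] and the sign becomes deterministic, so the walk is defined everywhere. *)
Definition walk_step (c : R) w v u := if u <= plus_prob c w v then w + v else w - v.

(** Recursion from an arbitrary start prepares the induction on the remaining vectors. The start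
    itself is not tested for membership in [G]. *)
Fixpoint stays_in (G : set 'rV[R]_n) (c : R) w vs (us : seq R) : Prop :=
  match vs, us with
  | v :: vs', u :: us' =>
      let w' := walk_step c w v u in G w' /\ stays_in G c w' vs' us'
  | _, _ => True
  end.

Lemma stays_inP G c w vs us (D : nat -> 'rV[R]_n) : size us = size vs ->
  D 0%N = w ->
  (forall t, D t.+1 = walk_step c (D t) (nth 0 vs t) (nth 0 us t)) ->
  stays_in G c w vs us <-> (forall t, (0 < t <= size vs)%N -> G (D t)).
Proof.
elim: vs w us D => [|v vs ih] w [|u us] D //=.
  by move=> _ _ _; split => // _ [].
move=> [sz] D0 DS.
have {}ih := ih (D 1%N) us (D \o S) sz erefl (fun t => DS t.+1).
have D1 : D 1%N = walk_step c w v u by rewrite DS D0.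
split=> [[G1 st] [|[|t]]// tT|h].
- by rewrite D1.
- by move: st; rewrite -D1 => /ih h; exact: (h t.+1).
split; first by rewrite -D1; exact: h.
by rewrite -D1; apply/ih => t /andP[_ tT]; exact: (h t.+1).
Qed.

Lemma stays_in_tupleS G c m w (V : m.+1.-tuple 'rV[R]_n) (U : m.+1.-tuple R) :
  stays_in G c w V U = (G (walk_step c w (thead V) (thead U)) /\
    stays_in G c (walk_step c w (thead V) (thead U)) (behead V) (behead U)).
Proof. by case/tupleP: V => v V; case/tupleP: U => u U. Qed.

Lemma measurable_walk_step d (T : measurableType d) c (W V : T -> 'rV[R]_n)
    (U : T -> R) :
  measurable_fun setT W -> measurable_fun setT V -> measurable_fun setT U ->
  measurable_fun setT (fun x => walk_step c (W x) (V x) (U x)).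
Proof.
move=> mW mV mU; apply: measurable_fun_ifT.
- apply: measurable_fun_ler => //; apply: measurable_funB => //.
  by apply: measurable_funM => //; exact: measurable_dotv.
- exact: measurable_rvD.
- exact: measurable_rvB.
Qed.

(** Start, vectors and uniform values are arbitrary measurable functions, so that the induction can
    take the next position as the new start. *)
Lemma measurable_stays_in d (T : measurableType d) (G : set 'rV[R]_n) c m
    (W : T -> 'rV[R]_n) (V : T -> m.-tuple 'rV[R]_n)
    (U : T -> m.-tuple (measurableTypeR R)) :
  measurable G -> measurable_fun setT W -> measurable_fun setT V ->
  measurable_fun setT U ->
  measurable [set x | stays_in G c (W x) (V x) (U x)].
Proof.
move=> mG; elim: m W V U => [|m ih] W V U mW mV mU.
  rewrite (_ : mkset _ = setT); first exact: measurableT.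
  by apply/seteqP; split => x //= _; rewrite (tuple0 (V x)).
pose W' x := walk_step c (W x) (thead (V x)) (thead (U x)).
have mW' : measurable_fun setT W'.
  apply: measurable_walk_step => //.
    exact: (measurableT_comp (@measurable_tnth _ _ m.+1 ord0) mV).
  exact: (measurableT_comp (@measurable_tnth _ _ m.+1 ord0) mU).
rewrite (_ : mkset _ = W' @^-1` G `&` [set x | stays_in G c (W' x)
    [tuple of behead (V x)] [tuple of behead (U x)]]); last first.
  by apply/seteqP; split => x /=; rewrite stays_in_tupleS.
apply: measurableI.
  by rewrite -[X in measurable X]setTI; exact: mW'.
apply: ih => //.
  exact: (measurableT_comp (@measurable_behead _ _ m) mV).
exact: (measurableT_comp (@measurable_behead _ _ m) mU).
Qed.

End walk.

(** * A potential that bounds the exit probability *)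

Section potential.
Context {R : realType} {n : nat} (c : R) (G : set 'rV[R]_n).
Variables (f1 : 'rV[R]_n -> 'rV[R]_n -> R) (fK : 'rV[R]_n -> R).
Hypothesis c1 : 1 <= c.
Hypothesis mG : measurable G.
Hypothesis f1_cvx : forall v, cvxmf (f1 v).
Hypothesis fK_cvx : cvxmf fK.
Hypothesis f1_ge1 : forall v w, c < `|dotv w v| -> 1 <= f1 v w.
Hypothesis fK_ge1 : forall w, ~ G w -> 1 <= fK w.

Let cvxmfD (f g : 'rV[R]_n -> R) : cvxmf f -> cvxmf g ->
  cvxmf (fun x => f x + g x).
Proof.
move=> [cf mf f0] [cg mg g0]; split.
- move=> x y t t0 t1; have := cf x y t t0 t1; have := cg x y t t0 t1.
  move: (f _) (f x) (f y) (g _) (g x) (g y) => ? ? ? ? ? ?; lra.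
- exact: measurable_funD.
- by move=> x; rewrite addr_ge0.
Qed.

(* The term [f1 v w] pays for the walk leaving the region where [plus_prob] is a
   probability, so that the average over the next step is only ever compared
   with [spread] inside that region. *)
Fixpoint potential (vs : seq 'rV[R]_n) : 'rV[R]_n -> R :=
  if vs is v :: vs' then
    fun w => f1 v w + spread c v (fun x => fK x + potential vs' x) w
  else fun=> 0.

Lemma cvxmf_potential vs : cvxmf (potential vs).
Proof.
elim: vs => [|v vs ih] /=.
  by split => // x y t _ _; rewrite !mulr0 addr0.
by apply: cvxmfD => //; apply: cvxmf_spread; exact: cvxmfD.
Qed.

Let sg : R := 2 / @far_prob R * Num.sqrt c.

(** By [integral_spread_le], [spread] does not increase the average at standard deviation [sg], so
    each vector adds at most [m1 + mK]. *)
Lemma integral_potential_le (m1 mK : \bar R) (vs : seq 'rV[R]_n) :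
  (forall v : 'rV[R]_n, dotv v v <= 1 ->
     (\int[std_gaussian R n]_x (f1 v (sg *: x))%:E <= m1)%E) ->
  (\int[std_gaussian R n]_x (fK (sg *: x))%:E <= mK)%E ->
  (forall v, v \in vs -> dotv v v <= 1) ->
  (\int[std_gaussian R n]_x (potential vs (sg *: x))%:E <=
   \sum_(v <- vs) (m1 + mK))%E.
Proof.
have ms (f : 'rV[R]_n -> R) : cvxmf f ->
    measurable_fun setT (fun x : 'rV[R]_n => (f (sg *: x))%:E).
  move=> [_ mf _]; apply/measurable_EFinP; apply: (measurableT_comp mf).
  exact: measurable_rvZ.
have ps (f : 'rV[R]_n -> R) : cvxmf f -> forall x, (0 <= (f (sg *: x))%:E)%E.
  by move=> [_ _ f0] x; rewrite lee_fin.
move=> h1 hK; elim: vs => [|v vs ih] hv /=.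
  by rewrite big_nil integral0.
have cp := cvxmf_potential vs; have cKp := cvxmfD fK_cvx cp.
rewrite big_cons -addeA.
under eq_integral do rewrite EFinD.
rewrite ge0_integralD//; last 4 first.
- by move=> x _; exact: ps.
- exact: ms.
- by move=> x _; apply: (ps _ (cvxmf_spread c v cKp)).
- by apply: (ms _ (cvxmf_spread c v cKp)).
apply: leeD; first by apply: h1; apply: hv; rewrite mem_head.
apply: le_trans (integral_spread_le cKp c1 (hv _ (mem_head _ _))) _.
under eq_integral do rewrite EFinD.
rewrite ge0_integralD//; last 4 first.
- by move=> x _; exact: ps.
- exact: ms.
- by move=> x _; exact: (ps _ cp).
- exact: (ms _ cp).
by apply: leeD => //; apply: ih => u us; apply: hv; rewrite in_cons us orbT.
Qed.

Local Notation unif := (uniform_prob (@ltr01 R)).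

Let unif_le (p : R) : 0 <= p -> p <= 1 ->
  unif [set u | u <= p] = p%:E.
Proof.
move=> p0 p1; rewrite /uniform_prob integral_uniform_pdf.
rewrite (_ : _ `&` _ = `[0, p]%classic); last first.
  apply/seteqP; split=> u /=; rewrite !in_itv/=.
    by move=> [up /andP[-> _]]; rewrite up.
  by move=> /andP[-> up]; split => //=; rewrite (le_trans up).
rewrite (eq_integral (cst 1%:E)); last first.
  move=> u; rewrite inE/= in_itv/= => /andP[u0 up].
  by rewrite /uniform_pdf u0 (le_trans up p1)/= subr0 invr1.
rewrite integral_cst//= mul1e lebesgue_measure_itv/= lte_fin.
case: ltP => [_|p0']; first by rewrite oppr0 adde0.
by congr (_%:E); apply/eqP; rewrite eq_le p0 p0'.
Qed.

(** Induction on the remaining vectors. If [|dotv w v| > c], the term [f1 v w] already exceeds the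
    probability. Otherwise, conditioning on the first uniform variable, [fK] pays for leaving [G]
    now, the potential at the next position pays for leaving later, and the average of both is at
    most [spread]. *)
Lemma stays_in_potential m (vs : m.-tuple 'rV[R]_n) w :
  (iid unif m (~` [set us | stays_in G c w vs us]) <= (potential vs w)%:E)%E.
Proof.
elim: m vs w => [|m ih] vs w.
  rewrite (tuple0 vs) (_ : ~` _ = set0); first by rewrite measure0.
  by apply/seteqP; split => us //= /(_ Logic.I).
case/tupleP: vs => v vs.
have mX k (ws : k.-tuple 'rV[R]_n) y :
    measurable (~` [set us : k.-tuple (measurableTypeR R) | stays_in G c y ws us]).
  apply: measurableC.
  exact: (@measurable_stays_in _ _ _ _ G c k (fun=> y) (fun=> ws) id).
have [c_lt|c_ge] := ltP c `|dotv w v|.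
  apply: (@le_trans _ _ 1%E); first by apply: probability_le1; exact: mX.
  rewrite lee_fin /=; have [_ _ s0] := cvxmf_spread c v
    (cvxmfD fK_cvx (cvxmf_potential vs)).
  by rewrite -[1]addr0 lerD// f1_ge1.
pose g x := fK x + potential vs x.
have cg : cvxmf g by apply: cvxmfD => //; exact: cvxmf_potential.
have [cvg mg g0] := cg.
apply: (@le_trans _ _ (spread c v g w)%:E); last first.
  have [_ _ f10] := f1_cvx v.
  by rewrite lee_fin /= lerDr.
have c0 : 0 < c by apply: lt_le_trans c1.
apply: le_trans (_ : _ <= (plus_prob c w v * g (w + v) +
   (1 - plus_prob c w v) * g (w - v))%:E)%E _; last first.
  by rewrite lee_fin; exact: walk_step_spread.
set p := plus_prob c w v.
have /andP[p0 p1] : 0 <= p <= 1.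
  have /andP[l1 l2] : -1 <= dotv w v / c <= 1.
    by rewrite -ler_norml normf_div (gtr0_norm c0) ler_pdivrMr// mul1r.
  rewrite /p /plus_prob invfM mulrA mulrAC.
  by apply/andP; split; lra.
pose B : set (measurableTypeR R) := [set u | u <= p].
have mB : measurable B.
  rewrite (_ : B = `]-oo, p]%classic); first exact: measurable_itv.
  by apply/seteqP; split => u; rewrite /B/= in_itv.
(* The two-point average becomes an integral over the first uniform variable, to be compared
   pointwise with the sections of the bad event. *)
have -> : (p * g (w + v) + (1 - p) * g (w - v))%:E =
   (\int[unif]_u ((g (w + v))%:E * (\1_B u)%:E +
      (g (w - v))%:E * (\1_(~` B) u)%:E))%E.
  have mIB : measurable_fun setT (fun u => (\1_B u)%:E : \bar R).
    exact/measurable_EFinP/measurable_indic.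
  have mIC : measurable_fun setT (fun u => (\1_(~` B) u)%:E : \bar R).
    exact/measurable_EFinP/measurable_indic/measurableC.
  rewrite ge0_integralD//; last 4 first.
  - by move=> u _; rewrite mule_ge0// lee_fin.
  - exact: emeasurable_funM.
  - by move=> u _; rewrite mule_ge0// lee_fin.
  - exact: emeasurable_funM.
  rewrite !ge0_integralZl//= ?lee_fin//.
  rewrite !integral_indic ?setIT//; last exact: measurableC.
  have HB : unif B = p%:E by exact: unif_le.
  have HC := probability_setC unif mB; rewrite [X in (_ - X)%E]HB -EFinB in HC.
  rewrite [X in (_ * X + _)%E]HB [X in (_ + _ * X)%E]HC -!EFinM -EFinD.
  by congr (_%:E); ring.
rewrite /= /distribution /pushforward /product_measure1/=.
set Y := _ @^-1` _.
have mY : measurable Y.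
  by rewrite -[Y]setTI; apply: measurable_tcons => //; exact: (mX _ (cons_tuple v vs)).
apply: ge0_le_integral => //.
- exact: measurable_fun_xsection.
- apply: emeasurable_funD; apply: emeasurable_funM => //;
    apply/measurable_EFinP; apply: measurable_indic => //.
  exact: measurableC.
move=> u _.
have -> : ((g (w + v))%:E * (\1_B u)%:E + (g (w - v))%:E * (\1_(~` B) u)%:E)%E =
    (g (walk_step c w v u))%:E.
  rewrite -!EFinM -EFinD !indicE in_setC /walk_step -/p; congr (_%:E).
  have [up|up] := boolP (u <= p).
    by rewrite mem_set//= mulr1 mulr0 addr0.
  rewrite memNset/=; first by rewrite mulr1 mulr0 add0r.
  by apply/negP.
have -> : xsection Y u = [set us : m.-tuple (measurableTypeR R) |
    ~ (G (walk_step c w v u) /\ stays_in G c (walk_step c w v u) vs us)].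
  by apply/seteqP; split => us; rewrite /xsection/= inE.
set w' := walk_step c w v u.
(* Inside [G] the section is the bad event of the remaining walk; outside it is the whole space, and
   [fK] is at least 1 there. *)
have [Gw|Gw] := pselect (G w').
  apply: (@le_trans _ _ (potential vs w')%:E); last first.
    by have [_ _ fK0] := fK_cvx; rewrite lee_fin lerDr.
  rewrite (_ : mkset _ = ~` [set us : m.-tuple (measurableTypeR R) |
    stays_in G c w' vs us]); first exact: ih.
  apply/seteqP; split => us /=; first by move=> h1 h2; apply: h1.
  by move=> h1 [_ h2].
apply: (@le_trans _ _ 1%E).
  apply: probability_le1.
  rewrite (_ : mkset _ = setT); first exact: measurableT.
  by apply/seteqP; split => us //= _ [].
have [_ _ pp0] := cvxmf_potential vs.
by rewrite lee_fin -[1]addr0 lerD// fK_ge1.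
Qed.

End potential.

(** * Exponential barrier for the drift *)

Section barriers.
Context {R : realType} {n : nat}.
Implicit Types (v w x : 'rV[R]_n).

Lemma norm2_le1 v : (norm2 v <= 1) = (dotv v v <= 1).
Proof. by rewrite /norm2 -[X in _ <= X]sqrtr1 ler_sqrt. Qed.

(** A Chernoff barrier for the event [c < |dotv x v|]. The sum of two exponentials dominates
    [exp (eta |dotv x v|)] and has a mean given by [std_gaussian_mgf]. *)
Definition drift_barrier (eta c : R) v x :=
  expR (- (eta * c)) * (expR (eta * dotv x v) + expR (- eta * dotv x v)).

Lemma cvxfun_expR_dotv (l : R) v : cvxfun (fun x => expR (l * dotv x v)).
Proof.
move=> x y t t0 t1.
have := convex_expR (Itv01 t0 t1) (l * dotv x v) (l * dotv y v).
rewrite !convRE /=; apply: le_trans; rewrite ler_expR dotvDl !dotvZl.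
by rewrite mulrDr ![l * (_ * dotv _ _)]mulrCA.
Qed.

Lemma cvxmf_drift_barrier eta c v : cvxmf (drift_barrier eta c v).
Proof.
split.
- move=> x y t t0 t1; rewrite /drift_barrier.
  have h1 := @cvxfun_expR_dotv eta v x y t t0 t1.
  have h2 := @cvxfun_expR_dotv (- eta) v x y t t0 t1.
  rewrite [X in _ <= X + _]mulrCA [X in _ <= _ + X]mulrCA -mulrDr ler_wpM2l ?expR_ge0//.
  by apply: le_trans (lerD h1 h2) _; rewrite !mulrDr addrACA.
- have me (l : R) : measurable_fun setT (fun x => expR (l * dotv x v)).
    apply: measurableT_comp => //; apply: measurable_funM => //.
    exact: measurable_dotv.
  by apply: measurable_funM => //; exact: measurable_funD.
- by move=> x; rewrite mulr_ge0 ?addr_ge0 ?expR_ge0.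
Qed.

Lemma drift_barrier_ge1 eta c v w : 0 <= eta -> c < `|dotv w v| ->
  1 <= drift_barrier eta c v w.
Proof.
move=> e0 cw; rewrite /drift_barrier mulrDr -!expRD.
have := @expR_ge0 R (- (eta * c) + eta * dotv w v).
have := @expR_ge0 R (- (eta * c) + - eta * dotv w v).
have [d0|d0] := leP 0 (dotv w v).
  rewrite ger0_norm// in cw.
  have : 1 <= expR (- (eta * c) + eta * dotv w v).
    by rewrite -expR0 ler_expR addrC subr_ge0 ler_wpM2l// ltW.
  by lra.
rewrite ltr0_norm// in cw.
have : 1 <= expR (- (eta * c) + - eta * dotv w v).
  by rewrite -expR0 ler_expR addrC mulNr -mulrN subr_ge0 ler_wpM2l// ltW.
by lra.
Qed.

Lemma integral_drift_barrier eta c v (s : R) : dotv v v <= 1 ->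
  (\int[std_gaussian R n]_x (drift_barrier eta c v (s *: x))%:E <=
   (2 * expR ((eta * s) ^+ 2 / 2 - eta * c))%:E)%E.
Proof.
move=> v1.
have me (l : R) : measurable_fun setT
    (fun x : 'rV[R]_n => (expR (dotv x (l *: v)))%:E : \bar R).
  by apply: measurable_expR_fun; exact: measurable_dotv.
under eq_integral.
  move=> x _; rewrite /drift_barrier dotvZl !mulrA -!dotvZr EFinM EFinD; over.
rewrite ge0_integralZl//; last 2 first.
- exact: emeasurable_funD.
- by move=> x _; rewrite -EFinD lee_fin addr_ge0 ?expR_ge0.
rewrite ge0_integralD//.
rewrite !std_gaussian_mgf -EFinD -EFinM lee_fin !dotvZl !dotvZr.
set D := dotv v v.
have -> : - eta * s * (- eta * s * D) = eta * s * (eta * s * D) by ring.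
rewrite [leLHS](_ : _ = 2 * (expR (- (eta * c)) *
  expR (eta * s * (eta * s * D) / 2))); last by ring.
rewrite -expRD ler_pM2l// ler_expR.
rewrite addrC lerD2r ler_pM2r ?invr_gt0// mulrA -expr2.
by rewrite ler_piMr// sqr_ge0.
Qed.

End barriers.

(** * The walk as an online algorithm *)

Section self_balancing.
Context {R : realType} {n : nat} (T : nat) (c : R).

(** Recovers the current position from the history. The length of [e] acts as the clock: a vector
    that has just arrived has no sign yet and does not contribute. *)
Definition signed_sum (e : seq bool) (vs : seq 'rV[R]_n) : 'rV[R]_n :=
  \sum_(i < size e) (if nth true e i then 1 else -1) *: nth 0 vs i.

(** The seed holds one uniform variable per step. With indices from 0, position [size e] is both the
    new vector and its uniform variable. *)
Definition balance_rule (vs : seq 'rV[R]_n) (e : seq bool)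
    (us : T.-tuple (measurableTypeR R)) : bool :=
  nth (0 : R) us (size e) <=
  plus_prob c (signed_sum e vs) (nth 0 vs (size e)).

Lemma measurable_nth d (U : measurableType d) m (x0 : U) i :
  measurable_fun setT (fun t : m.-tuple U => nth x0 t i).
Proof.
have [im|mi] := ltnP i m.
  rewrite (_ : (fun t => _) = @tnth m U ^~ (Ordinal im)).
    exact: measurable_tnth.
  by apply/funext => t; rewrite (tnth_nth x0).
rewrite (_ : (fun t => _) = cst x0); first exact: measurable_cst.
by apply/funext => t; rewrite nth_default// size_tuple.
Qed.

Lemma measurable_balance_rule (t : nat) (e : seq bool) :
  measurable_fun [set: t.-tuple 'rV[R]_n * T.-tuple (measurableTypeR R)]
    (fun x => balance_rule (tval x.1) e x.2).
Proof.
have mn i : measurable_fun setT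
    (fun x : t.-tuple 'rV[R]_n * T.-tuple (measurableTypeR R) =>
       nth (0 : 'rV[R]_n) x.1 i).
  exact: (measurableT_comp (@measurable_nth _ 'rV[R]_n t 0 i)).
apply: measurable_fun_ler.
  exact: (measurableT_comp (@measurable_nth _ (measurableTypeR R) T 0 (size e))).
apply: measurable_funB => //; apply: measurable_funM => //.
apply: measurable_dotv => //; apply: measurable_rv_sum => i.
exact: measurable_rvZ.
Qed.

Definition balance : online_alg R n :=
  @OnlineAlg R n _ _ (iid (uniform_prob (@ltr01 R)) T) balance_rule
    measurable_balance_rule.

Lemma size_signs (vs : seq 'rV[R]_n) (us : seed balance) t :
  size (signs vs us t) = t.
Proof. by elim: t => //= t ih; rewrite size_rcons ih. Qed.

Lemma disc_balanceS (vs : seq 'rV[R]_n) (us : T.-tuple (measurableTypeR R)) t :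
  @disc R n balance vs us t.+1 =
  walk_step c (@disc R n balance vs us t) (nth 0 vs t) (nth (0 : R) us t).
Proof.
have sz := size_signs vs us t.
have ssE : signed_sum (@signs R n balance vs us t) (take t.+1 vs) =
    @disc R n balance vs us t.
  rewrite /signed_sum /disc sz; apply: eq_bigr => i _.
  by rewrite nth_take// ltnS ltnW.
rewrite {1}/disc big_ord_recr /= nth_rcons sz ltnn eqxx.
rewrite (eq_bigr (fun i : 'I_t => (if nth true (@signs R n balance vs us t) i
   then 1 else -1) *: nth 0 vs i)); last first.
  by move=> i _; rewrite nth_rcons sz ltn_ord.
rewrite -/(@disc R n balance vs us t) /balance_rule ssE sz nth_take//.
rewrite /walk_step; case: ifP => _; first by rewrite scale1r.
by rewrite scaleN1r.
Qed.

Lemma balance_stays_in (G : set 'rV[R]_n) (vs : T.-tuple 'rV[R]_n)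
    (us : T.-tuple (measurableTypeR R)) :
  stays_in G c 0 vs us <->
  (forall t : nat, (0 < t <= T)%N -> G (@disc R n balance vs us t)).
Proof.
have := @stays_inP _ _ G c 0 vs us (@disc R n balance vs us).
rewrite (size_tuple vs) (size_tuple us); apply => //.
- by rewrite /disc big_ord0.
- by move=> t; exact: disc_balanceS.
Qed.

(** Fubini in the vectors: sequences leaving the unit ball are null because [p] is supported in it,
    and for every other fixed sequence the failure probability is at most [e]. *)
Lemma balance_good_prob (G : set 'rV[R]_n) (p : probability 'rV[R]_n R) (e : R) :
  measurable G -> 0 <= e -> supported_in_unit_ball p ->
  (forall vs : T.-tuple 'rV[R]_n, (forall v, v \in vs -> dotv v v <= 1) ->
    (iid (uniform_prob (@ltr01 R)) T (~` [set us | stays_in G c 0 vs us])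
       <= e%:E)%E) ->
  ((1 - e)%:E <= (iid p T \x seed_law balance)
     [set x | forall t : nat, (0 < t <= T)%N ->
        G (@disc R n balance (tval x.1) x.2 t)])%E.
Proof.
move=> mG e0 supp hvs.
set E := [set x | _].
have EE : E = [set x : T.-tuple 'rV[R]_n * T.-tuple (measurableTypeR R) |
    stays_in G c 0 x.1 x.2].
  by apply/seteqP; split => x /=; rewrite balance_stays_in.
have mE : measurable E by rewrite EE; apply: measurable_stays_in.
have mb : measurable [set v : 'rV[R]_n | norm2 v <= 1].
  rewrite (_ : mkset _ = (fun v => dotv v v) @^-1` `]-oo, 1]%classic).
    rewrite -[X in measurable X]setTI.
    have : measurable_fun setT (fun v : 'rV[R]_n => dotv v v).
      exact: measurable_dotv.
    by apply => //; exact: measurable_itv.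
  by apply/seteqP; split => v /=; rewrite in_itv/= norm2_le1.
pose D := [set vs : T.-tuple 'rV[R]_n | forall i, norm2 (tnth vs i) <= 1].
have mD : measurable D.
  rewrite (_ : D = \bigcap_(i in [set: 'I_T])
      ((fun x => tnth x i) @^-1` [set v | norm2 v <= 1])); last first.
    by apply/seteqP; split=> x /= h i => [_|]; exact: h.
  apply: fin_bigcap_measurable => // i _.
  by rewrite -[X in measurable X]setTI; exact: measurable_tnth.
have PD : iid p T D = 1%E.
  have := @iid_box _ _ _ p T (fun=> [set v | norm2 v <= 1]) (fun=> mb).
  by rewrite /D => ->; rewrite big1.
have PDC : iid p T (~` D) = 0%E by rewrite probability_setC// PD subee.
suff bad : ((iid p T \x seed_law balance) (~` E) <= e%:E)%E.
  pose Q : probability _ R := (iid p T \x seed_law balance)%E.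
  have hC : Q (~` E) = (1 - Q E)%E := probability_setC Q mE.
  have hfin : Q E \is a fin_num := fin_num_measure Q _ mE.
  have {}bad : (Q (~` E) <= e%:E)%E := bad.
  change ((1 - e)%:E <= Q E)%E.
  move: hfin bad; rewrite hC; case: (Q E) => // r _.
  by rewrite -EFinB !lee_fin; lra.
rewrite /product_measure1 /=.
apply: (@le_trans _ _ (\int[iid p T]_vs (e%:E + (\1_(~` D) vs)%:E))%E); last first.
  rewrite ge0_integralD//; last first.
    exact/measurable_EFinP/measurable_indic/measurableC.
  rewrite integral_cst// [X in (_ * X + _)%E]probability_setT mule1.
  rewrite integral_indic ?setIT//; last exact: measurableC.
  by rewrite [X in (_ + X)%E]PDC adde0.
apply: ge0_le_integral => //.
- by apply: measurable_fun_xsection; exact: measurableC.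
- apply: emeasurable_funD => //.
  exact/measurable_EFinP/measurable_indic/measurableC.
move=> vs _; have [Dvs|Dvs] := pselect (D vs); last first.
  rewrite indicE mem_set//=; apply: (@le_trans _ _ 1%E).
    by apply: probability_le1; apply: measurable_xsection; exact: measurableC.
  by rewrite leeDr.
rewrite indicE memNset//= adde0.
have -> : xsection (~` E) vs =
    ~` [set us : T.-tuple (measurableTypeR R) | stays_in G c 0 vs us].
  by rewrite EE; apply/seteqP; split => us; rewrite /xsection/= inE.
apply: hvs => v /tnthP[i ->]; have := Dvs i.
by rewrite norm2_le1.
Qed.

End self_balancing.

(** * Choice of constants and conclusion *)

Lemma ln2_ge_half (R : realType) : 2^-1 <= ln 2 :> R.
Proof.
have := expR_ge1Dx (- ln 2 : R); rewrite expRN lnK ?posrE//.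
by lra.
Qed.

Theorem theorem1p4 (R : realType) (c a : R) (c0 : 0 < c) (a0 : 0 < a) :
  exists2 C : R, 0 < C &
  forall (n T : nat) (K : set 'rV[R]_n) (p : probability 'rV[R]_n R),
    (0 < n)%N -> (0 < T)%N ->
    symmetric_convex_body K ->
    ((2^-1)%:E <= std_gaussian R n K)%E ->
    sub_exponential_tails p c ->
    supported_in_unit_ball p ->
    exists A : online_alg R n,
      ((1 - (n * T)%:R `^ (- a))%:E <=
       (iid p T \x seed_law A)
         [set x : T.-tuple 'rV[R]_n * seed A |
           forall t : nat, (0 < t <= T)%N ->
             [set (C * ln (n * T)%:R ^+ 5)%R *: y | y in K]
               (disc (tval x.1) x.2 t)])%E.
Proof.
have ln2 := ln2_ge_half R.
have ln20 : 0 < ln 2 :> R by apply: lt_le_trans ln2; rewrite invr_gt0.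
(* The factor in the standard deviation [s0 * sqrt cc] required by [integral_spread_le]. *)
pose s0 : R := 2 / @far_prob R.
have s02 : 2 <= s0.
  by rewrite /s0 ler_pdivlMr ?far_prob_gt0// ler_piMr// far_prob_le1.
have s00 : 0 < s0 by apply: lt_le_trans s02.
pose lam : R := ln 2 / 16.
have lam0 : 0 < lam by rewrite divr_gt0.
(* Chosen so that [s0 * cc * S = C1 * L^2] below. *)
pose C1 : R := 2 * s0 ^+ 3 * (a + 3) * (a + 4) / lam.
have C10 : 0 < C1.
  by rewrite divr_gt0//; do !apply: mulr_gt0 => //; rewrite ?exprn_gt0 ?addr_gt0.
(* The walk is kept within [C1 * L^2] times [K]; as [L >= ln 2], division by [ln 2 ^+ 3] accounts
   for the other three factors [L]. *)
exists (C1 / ln 2 ^+ 3); first by rewrite divr_gt0// exprn_gt0.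
move=> n T K p n0 T0 sK hK _ supp.
(* For [n T = 1] the required probability is [1 - 1 = 0], so any algorithm will do. *)
have [nT1|nT2] := leqP (n * T) 1.
  have -> : (n * T)%N = 1%N by apply/eqP; rewrite eqn_leq nT1 muln_gt0 n0.
  exists (balance T 1); rewrite powR1 subrr; exact: measure_ge0.
set E : R := (n * T)%:R.
have E2 : 2 <= E by rewrite ler_nat.
have E0 : 0 < E by apply: lt_le_trans E2.
pose L := ln E; rewrite -/L.
have EL : expR L = E by rewrite lnK// posrE.
have Lln2 : ln 2 <= L by rewrite ler_ln ?posrE.
have L0 : 0 < L by apply: lt_le_trans Lln2.
(* With [eta = s0^(-2)] the drift barrier has mean at most [2 exp (- cc / (2 s0^2)) = 2 exp (- (a +
   3) L)]. *)
pose cc : R := 2 * s0 ^+ 2 * (a + 3) * L.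
have cc1 : 1 <= cc.
  have h1 : 4 <= s0 ^+ 2 by rewrite expr2; nra.
  have h2 : 2^-1 <= L by exact: le_trans Lln2.
  have h3 : 12 <= s0 ^+ 2 * (a + 3) by nra.
  have : 12 * 2^-1 <= s0 ^+ 2 * (a + 3) * L by apply: ler_pM => //; rewrite invr_ge0.
  have -> : cc = 2 * (s0 ^+ 2 * (a + 3) * L) by rewrite /cc; ring.
  by clear; move: (s0 ^+ 2 * _ * _) => x; lra.
have cc0 : 0 < cc by apply: lt_le_trans cc1.
(* Makes [lam * S = (a + 4) * L], so that Fernique's bound gives a mean of at most
   [4 exp (- (a + 4) L)] for [fK] below. *)
pose S : R := (a + 4) * L / lam.
have S0 : 0 < S by rewrite divr_gt0// mulr_gt0// addr_gt0.
pose sg : R := s0 * Num.sqrt cc.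
have sg0 : 0 < sg by rewrite mulr_gt0// sqrtr_gt0.
set s := C1 / _ * _.
have sgS : sg * S <= s.
  have sqle : Num.sqrt cc <= cc.
    rewrite -[leRHS](sqr_sqrtr (ltW cc0)) expr2 ler_peMr ?sqrtr_ge0//.
    by rewrite -[leLHS]sqrtr1 ler_sqrt// ltW.
  apply: (@le_trans _ _ (C1 * L ^+ 2)).
    apply: (@le_trans _ _ (s0 * cc * S)).
      by rewrite ler_wpM2r ?(ltW S0)// /sg ler_pM2l.
    by rewrite /C1 /cc /S le_eqVlt; apply/orP; left; apply/eqP; field; rewrite gt_eqF.
  rewrite /s -mulrA ler_pM2l// mulrC ler_pdivlMr ?exprn_gt0//.
  rewrite -[5%N]/(2 + 3)%N exprD ler_pM2l ?exprn_gt0//.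
  by apply: lerXn2r => //; rewrite nnegrE ltW.
have s_gt0 : 0 < s by apply: lt_le_trans sgS; rewrite mulr_gt0.
pose G : set 'rV[R]_n := [set s *: y | y in K].
have GE : G = (fun x => s^-1 *: x) @^-1` K.
  apply/seteqP; split => [x [y Ky <-]|x /= Kx].
    by rewrite /= scalerA mulVf ?gt_eqF// scale1r.
  by exists (s^-1 *: x) => //; rewrite scalerA mulfV ?gt_eqF// scale1r.
have mG : measurable G.
  rewrite GE -[X in measurable X]setTI.
  have : measurable_fun setT (fun x : 'rV[R]_n => s^-1 *: x).
    exact: measurable_rvZ.
  by apply => //; exact: measurable_convex_body sK.
pose f1 := @drift_barrier R n (s0 ^- 2) cc.
(* The slope [lam / sg] becomes [lam] at scale [sg]; outside [G] the gauge is at least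
   [s >= sg * S], so the exponent is nonnegative. *)
pose fK x := expR (- (lam * S)) * expR (lam / sg * gauge K x).
have ls0 : 0 <= lam / sg by rewrite divr_ge0// ltW.
have fK_cvx : cvxmf fK.
  have cg := cvxfun_gauge_expR sK ls0.
  split.
  - move=> x y t t0 t1; rewrite /fK.
    rewrite [X in _ <= X + _]mulrCA [X in _ <= _ + X]mulrCA -mulrDr.
    by rewrite ler_wpM2l ?expR_ge0// cg.
  - apply: measurable_funM => //; apply: measurableT_comp => //.
    by apply: measurable_funM => //; exact: measurable_gauge sK.
  - by move=> x; rewrite mulr_ge0 ?expR_ge0.
have fK_ge1 w : ~ G w -> 1 <= fK w.
  rewrite GE /= => Gw; rewrite /fK -expRD -expR0 ler_expR addrC subr_ge0.
  have sw : s <= gauge K w.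
    by rewrite leNgt; apply/negP => /(gauge_lt sK).
  rewrite [leRHS]mulrAC ler_pdivlMr// -[leLHS]mulrA ler_pM2l// mulrC.
  exact: le_trans sw.
have f1_ge1 v w : cc < `|dotv w v| -> 1 <= f1 v w.
  by apply: drift_barrier_ge1; rewrite invr_ge0 exprn_ge0// ltW.
have f1_cvx v : cvxmf (f1 v) by exact: cvxmf_drift_barrier.
exists (balance T cc); apply: balance_good_prob => //.
  exact: powR_ge0.
move=> vs hv.
(* The failure probability is at most the potential at the start [0], hence at most its Gaussian
   mean, hence at most [T] times the cost of one step. *)
apply: le_trans (stays_in_potential cc1 mG f1_cvx fK_cvx f1_ge1 fK_ge1 vs 0) _.
apply: le_trans (cvxmf_gaussian_mean sg
  (cvxmf_potential cc f1_cvx fK_cvx vs)) _.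
apply: le_trans (@integral_potential_le R n cc f1 fK cc1 f1_cvx fK_cvx
  (2 * expR (- ((a + 3) * L)))%:E (4 * expR (- ((a + 4) * L)))%:E vs _ _ hv) _.
- move=> v v1; apply: le_trans (integral_drift_barrier _ _ _ v1) _.
  rewrite lee_fin ler_pM2l// ler_expR.
  rewrite -/s0 -/sg [(s0 ^- 2 * sg) ^+ 2]exprMn /sg [(s0 * _) ^+ 2]exprMn.
  rewrite (sqr_sqrtr (ltW cc0)) /cc le_eqVlt; apply/orP; left; apply/eqP.
  by field; rewrite gt_eqF.
- have -> : (fun x : 'rV[R]_n => (fK (sg *: x))%:E) =
      fun x => ((expR (- (lam * S)))%:E * (expR (lam * gauge K x))%:E)%E.
    apply/funext => x; rewrite /fK (gaugeZ sK) ?ltW// -EFinM mulrA divfK//.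
    by rewrite gt_eqF.
  rewrite ge0_integralZl//; last first.
    apply: measurable_expR_fun; apply: measurable_funM => //.
    exact: measurable_gauge sK.
  rewrite muleC EFinM; apply: lee_pmul.
  + by apply: integral_ge0 => x _; rewrite lee_fin expR_ge0.
  + by rewrite lee_fin expR_ge0.
  + exact: gauge_fernique.
  + by rewrite lee_fin ler_expR /S mulrCA mulfV ?mulr1// gt_eqF.
rewrite -EFinD sumEFin big_const_seq count_predT size_tuple iter_addr_0 lee_fin.
(* The total is [A * (2 x^2 + 4 x^3) * (x T)]. Here [x T <= 1] because [n >= 1], and
   [2 x^2 + 4 x^3 <= 1] because [x <= 1/2]. *)
pose x := E^-1; pose A := expR (- a * L).
have powE (k : nat) : expR (- ((a + k%:R) * L)) = A * x ^+ k.
  by rewrite /A /x -EL -expRN -expRM_natr -expRD; congr expR; ring.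
have -> : E `^ (- a) = A by rewrite /powR gt_eqF.
rewrite (powE 3%N) (powE 4%N) -[leLHS]mulr_natr.
have A0 : 0 <= A by exact: expR_ge0.
have x0 : 0 <= x by rewrite invr_ge0 ltW.
have x2 : x <= 2^-1 by rewrite lef_pV2 ?posrE.
have Tx : x * T%:R <= 1.
  by rewrite mulrC ler_pdivrMr// mul1r ler_nat leq_pmull.
have -> : (2 * (A * x ^+ 3) + 4 * (A * x ^+ 4)) * T%:R =
    A * ((2 * x ^+ 2 + 4 * x ^+ 3) * (x * T%:R)) by ring.
rewrite ler_piMr//.
have xx : x ^+ 2 <= 2^-1 ^+ 2 by apply: lerXn2r => //; rewrite nnegrE ?invr_ge0.
have xxx : x ^+ 3 <= 2^-1 ^+ 3 by apply: lerXn2r => //; rewrite nnegrE ?invr_ge0.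
have y0 : 0 <= x * T%:R by rewrite mulr_ge0.
rewrite -[leRHS]mulr1; apply: ler_pM => //.
  by rewrite addr_ge0// mulr_ge0// exprn_ge0.
by move: xx xxx; rewrite !exprVn -!natrX; lra.
Qed.
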